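(* Let $d\ge 1$ and consider independent site percolation on $\mathbb{Z}^d$ with parameter $p$, where $0<p<p_c$. Let $\zeta=\zeta(p,d)=\lim_{n\to\infty}-\frac1n\log\mathbb{P}_p(|\mathcal{C}(0)|\ge n)\in(0,\infty)$, and assume that $$\lim_{n\to\infty}\frac{\mathbb{P}_p(|\mathcal{C}(0)|\ge n+1)}{\mathbb{P}_p(|\mathcal{C}(0)|\ge n)}=e^{-\zeta}.$$ Then there exist a sequence $u_n\in\mathbb{N}$ with $u_n\to\infty$, a real number $a>0$ and a bounded sequence $a_n\in[a,1]$ such that for all $x\in\mathbb{N}$, as $n\to\infty$, $$\mathbb{P}_p(\mathcal{M}_n\le u_n+x)=e^{-a_ne^{-x\zeta}}+o(1).$$
   Context: $\Omega=\{0,1\}^{\mathbb{Z}^d}$; under $\mathbb{P}_p$ the coordinates $\omega(x)$, $x\in\mathbb{Z}^d$, are i.i.d. with $\mathbb{P}_p(\omega(x)=1)=p$. A site $x$ is occupied if $\omega(x)=1$ and vacant otherwise. The cluster $\mathcal{C}(x)=\mathcal{C}(x,\omega)$ of an occupied site $x$ is the largest nearest-neighbour connected set of occupied sites containing $x$; $\mathcal{C}(x)=\emptyset$ if $x$ is vacant. The critical value $p_c=p_c(d)$ is such that a.s. there is no infinite cluster for $p<p_c$ and a.s. there is one for $p>p_c$ (with $p_c(1)=1$). The left endpoint of a set is its minimum in the lexicographic order; $\mathcal{C}_{\rm le}(x,\omega)=\mathcal{C}(x,\omega)$ if $x$ is the left endpoint of $\mathcal{C}(x,\omega)$, and $\mathcal{C}_{\rm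 le}(x,\omega)=\emptyset$ otherwise. $B_n=[-n,n]^d\cap\mathbb{Z}^d$; $\omega_{B_n}$ denotes the configuration equal to $\omega$ on $B_n$ and to $0$ off $B_n$. The maximal cluster size is $\mathcal{M}_n=\max_x|\mathcal{C}_{\rm le}(x,\omega_{B_n})|$. For $0<p<p_c$ the limit defining $\zeta$ is known to exist and to be positive. *)

(* Defs.v *)
From HB Require Import structures.
From mathcomp Require Import all_boot all_order all_algebra finmap.
From mathcomp Require Import all_classical all_reals all_analysis.

Set Implicit Arguments.
Unset Strict Implicit.
Unset Printing Implicit Defensive.

Import Order.TTheory GRing.Theory Num.Theory.
Import numFieldNormedType.Exports.

Local Open Scope classical_set_scope.
Local Open Scope ring_scope.

Notation site d := 'rV[int]_d.

(* Omega = {0,1}^(Z^d) with the sigma-algebra generated by the coordinates;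
   [true] means occupied. *)
Definition cylinder1 d : set_system (site d -> bool) :=
  [set A | exists x : site d, A = [set w : site d -> bool | w x]].

Notation config d := (g_sigma_algebraType (@cylinder1 d)).

(* Independence of a family of {0,1}-valued variables: the product rule holds
   over every finite subfamily. *)
Definition mutually_independent (dT : measure_display) (T : measurableType dT)
    (R : realType) (P : probability T R) (I : choiceType)
    (X : I -> T -> bool) : Prop :=
  forall (J : {fset I}) (B : I -> set bool),
    fine (P (\bigcap_(i in [set` J]) (X i @^-1` B i))) =
    \prod_(i <- J) fine (P (X i @^-1` B i)).

Definition site_percolation (R : realType) d (p : R)
    (P : probability (config d) R) : Prop :=
  mutually_independent P (fun (x : site d) (w : config d) => w x) /\
  forall x : site d, P [set w : config d | w x] = p%:E.

Section Clusters.
Variable d : nat.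
Implicit Types (x y : site d) (w : site d -> bool) (A : set (site d)).

Definition neighbour x y : bool := \sum_(i < d) `|x 0 i - y 0 i| == 1.

Definition nn_connected A : Prop :=
  forall x y, A x -> A y -> exists s : seq (site d),
    [/\ path neighbour x s, last x s = y & forall z, z \in s -> A z].

(* The largest nearest-neighbour connected set of occupied sites containing x,
   namely the union of all of them; there are none when x is vacant. *)
Definition site_cluster w x : set (site d) :=
  \bigcup_(A in [set A | [/\ A x, A `<=` [set y | w y] & nn_connected A]]) A.

Definition lex_le x y : bool :=
  (([tuple x 0 i | i < d] : d.-tuplelexi int) <= [tuple y 0 i | i < d])%O.

Definition left_endpoint A x : Prop := A x /\ forall y, A y -> lex_le x y.

Definition cluster_le w x : set (site d) :=
  [set y | left_endpoint (site_cluster w x) x /\ site_cluster w x y].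

Definition in_box (n : nat) x : bool := [forall i, `|x 0 i| <= n%:Z].

Definition restrict_box (n : nat) w : site d -> bool :=
  fun x => in_box n x && w x.

(* [fset_set] is faithful here, since all these clusters lie in B_n. The maximum
   is over all x in Z^d: clusters are empty for all but finitely many x. *)
Definition max_cluster (n : nat) w : nat :=
  \big[maxn/0%N]_(x \in [set: site d])
    #|` fset_set (cluster_le (restrict_box n w) x)|.

(* Cardinal comparison, so that infinite clusters count as size >= n. *)
Definition cluster0_ge (n : nat) w : Prop := (`I_n #<= site_cluster w 0)%card.

Definition infinite_cluster w : Prop := exists x, infinite_set (site_cluster w x).

End Clusters.

Definition is_critical_value (R : realType) d
    (P : R -> probability (config d) R) (pc : R) : Prop :=
  [/\ 0 <= pc <= 1,
      forall p : R, 0 <= p <= 1 -> p < pc ->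
        {ae P p, forall w : config d, ~ infinite_cluster w} &
      forall p : R, 0 <= p <= 1 -> pc < p ->
        {ae P p, forall w : config d, infinite_cluster w}].

Definition cluster_tail (R : realType) d (P : probability (config d) R)
    (n : nat) : R :=
  fine (P [set w : config d | cluster0_ge n w]).

(* Main.v *)
(** The maximum of the cluster sizes in B_n is at least m iff some site of B_n is
    the left endpoint of a cluster of size at least m. Truncating the size at
    L makes the events X_x, that x is the left endpoint of its cluster C(x) and
    m <= |C(x)| < L, local: X_x depends only on the sites at distance at most L
    from x. Adding the sites of B_n one by one then gives
    P(no X_x) = (1 - P(X_0))^|B_n| up to |B_n| (4 L + 1)^d times a bound on
    P(X_x, X_y) + P(X_0)^2, and P(X_x, X_y) <= P(|C(0)| >= m)^2 for x <> y by
    conditioning on C(x). By mass transport P(X_0) is close to T(m) / m, where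
    T(m) = P(|C(0)| >= m). Taking u_n to be the least k with
    |B_n| T(k+1) / (k+1) <= 1, the intensity a_n = |B_n| T(u_n+1) / (u_n+1) is
    bounded away from 0 by the ratio hypothesis, which also makes u_n
    logarithmic in n; with m = u_n + 1 + x and L = 2 (u_n + 1) + x all errors
    vanish. *)
Require Import Defs.
From HB Require Import structures.
From mathcomp Require Import all_boot all_order all_algebra finmap.
From mathcomp Require Import all_classical all_reals all_analysis.
From mathcomp Require Import ring lra zify.

Import Order.TTheory GRing.Theory Num.Theory.
Import numFieldNormedType.Exports.

Local Open Scope classical_set_scope.
Local Open Scope ring_scope.

Set Implicit Arguments.
Unset Strict Implicit.

(** * Real-valued probabilities, union bounds and counting bounds *)

Section RealProbability.
Context {dT : measure_display} {T : measurableType dT} {R : realType}.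
Variable P : probability T R.
Implicit Types (A B E : set T).

(** [max_cluster] sees a configuration cut at the boundary of B_n, while translation invariance and
    mass transport concern clusters of the full configuration; passing between them costs a boundary
    layer of thickness L. So L must be of order u_n, to cost only powers of u_n. Yet |B_n| T(L) has
    to vanish although |B_n| T(u_n + 1) may be as large as u_n + 1: doubling the length gains a
    factor exp(- (u_n + 1) zeta / 2), which beats every power. The factor exp(- x zeta) of the limit
    is a product of x successive tail ratios. Mass transport bounds P(X_0) from above by T(m) / m at
    once. For the lower bound only sizes in [m, m + j) are kept: they have probability T(m) - T(m +
    j), about (1 - exp(- j zeta)) T(m), and j grows only after n. Independence is given as a product
    rule for finite families of coordinates. It is extended to events depending on finitely many
    sites by fixing one coordinate at a time, which is why every event is kept local. *)

Definition pr A : R := fine (P A).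

Lemma prE A : measurable A -> (pr A)%:E = P A.
Proof. by move=> mA; rewrite /pr fineK// fin_num_measure. Qed.

Lemma pr_ge0 A : 0 <= pr A.
Proof. exact: fine_ge0. Qed.

Lemma pr_le A B : measurable A -> measurable B -> A `<=` B -> pr A <= pr B.
Proof.
by move=> mA mB AB; rewrite -lee_fin !prE//; apply: le_measure; rewrite ?inE.
Qed.

Lemma pr_le1 A : measurable A -> pr A <= 1.
Proof. by move=> mA; rewrite -lee_fin prE// probability_le1. Qed.

Lemma pr_set0 : pr set0 = 0.
Proof. by rewrite /pr measure0. Qed.

Lemma pr_setT : pr setT = 1.
Proof. by rewrite /pr probability_setT. Qed.

Lemma prU A B : measurable A -> measurable B -> A `&` B = set0 ->
  pr (A `|` B) = pr A + pr B.
Proof.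
move=> mA mB AB0; apply: EFin_inj.
by rewrite EFinD !prE//; [rewrite measureU|exact: measurableU].
Qed.

Lemma prID A B : measurable A -> measurable B ->
  pr A = pr (A `&` B) + pr (A `&` ~` B).
Proof.
move=> mA mB; rewrite -[in LHS](setIT A) -(setUv B) setIUr prU//.
- exact: measurableI.
- by apply: measurableI => //; exact: measurableC.
- by rewrite setIACA setICr setI0.
Qed.

Lemma prC A : measurable A -> pr (~` A) = 1 - pr A.
Proof.
by move=> mA; rewrite -pr_setT (prID (A := setT) (B := A))// !setTI addrAC subrr add0r.
Qed.

Lemma pr_bigU_le (I : eqType) (s : seq I) (F : I -> set T) A :
  measurable A -> (forall i, measurable (F i)) ->
  (forall t, A t -> exists2 i, i \in s & F i t) ->
  pr A <= \sum_(i <- s) pr (F i).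
Proof.
move=> mA mF; elim: s A mA => [|i s IHs] A mA AF.
  rewrite big_nil (_ : A = set0) ?pr_set0//.
  by rewrite -subset0 => t /AF[].
rewrite big_cons (prID (A := A) (B := F i))//.
apply: lerD; first by apply: pr_le => //; exact: measurableI.
apply: IHs; first by apply: measurableI => //; exact: measurableC.
move=> t [/AF[j]]; rewrite inE => /predU1P[->//|js Fjt _].
by exists j.
Qed.

(* Double counting: these are the two halves of
   E[#{i in s | F i}; E] = \sum_i Pr (E `&` F i). *)
Lemma pr_count_ge (I : Type) (s : seq I) (F : I -> set T) E (c : R) :
  measurable E -> (forall i, measurable (F i)) ->
  (forall t, E t -> c <= (count (fun i => `[< F i t >]) s)%:R) ->
  c * pr E <= \sum_(i <- s) pr (E `&` F i).
Proof.
move=> mE mF; elim: s E mE c => [|i s IHs] E mE c cE.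
  rewrite big_nil; have [->|/set0P[t Et]] := eqVneq E set0.
    by rewrite pr_set0 mulr0.
  by rewrite mulr_le0_ge0 ?pr_ge0//; exact: cE Et.
have mEF : measurable (E `&` F i) by exact: measurableI.
have mEF' : measurable (E `&` ~` F i).
  by apply: measurableI => //; exact: measurableC.
have -> : \sum_(j <- i :: s) pr (E `&` F j) =
    pr (E `&` F i) + (\sum_(j <- s) pr (E `&` F i `&` F j) +
    \sum_(j <- s) pr (E `&` ~` F i `&` F j)).
  rewrite big_cons -big_split/=; congr (_ + _); apply: eq_bigr => j _.
  rewrite (prID (A := E `&` F j) (B := F i))//; last exact: measurableI.
  by rewrite [E `&` F j `&` _]setIAC [E `&` F j `&` ~` _]setIAC.
(* Inside [F i] one unit of the count is already spent, so [c] drops by one there. *)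
have h1 := IHs _ mEF (c - 1).
have h2 := IHs _ mEF' c.
rewrite (prID (A := E) (B := F i))//.
suff : (c - 1) * pr (E `&` F i) <= \sum_(j <- s) pr (E `&` F i `&` F j) /\
   c * pr (E `&` ~` F i) <= \sum_(j <- s) pr (E `&` ~` F i `&` F j) by lra.
split.
  by apply: h1 => t [/cE + Fit]; rewrite /= asboolT// natrD lerBlDl.
by apply: h2 => t [/cE + Fit]; rewrite /= asboolF.
Qed.

Lemma pr_count_le (I : Type) (s : seq I) (F : I -> set T) E (c : R) :
  measurable E -> (forall i, measurable (F i)) ->
  (forall t, E t -> (count (fun i => `[< F i t >]) s)%:R <= c) ->
  \sum_(i <- s) pr (E `&` F i) <= c * pr E.
Proof.
move=> mE mF; elim: s E mE c => [|i s IHs] E mE c cE.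
  rewrite big_nil; have [->|/set0P[t Et]] := eqVneq E set0.
    by rewrite pr_set0 mulr0.
  by rewrite mulr_ge0 ?pr_ge0//; exact: cE Et.
have mEF : measurable (E `&` F i) by exact: measurableI.
have mEF' : measurable (E `&` ~` F i).
  by apply: measurableI => //; exact: measurableC.
have -> : \sum_(j <- i :: s) pr (E `&` F j) =
    pr (E `&` F i) + (\sum_(j <- s) pr (E `&` F i `&` F j) +
    \sum_(j <- s) pr (E `&` ~` F i `&` F j)).
  rewrite big_cons -big_split/=; congr (_ + _); apply: eq_bigr => j _.
  rewrite (prID (A := E `&` F j) (B := F i))//; last exact: measurableI.
  by rewrite [E `&` F j `&` _]setIAC [E `&` F j `&` ~` _]setIAC.
have h1 := IHs _ mEF (c - 1).
have h2 := IHs _ mEF' c.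
rewrite (prID (A := E) (B := F i))//.
suff : \sum_(j <- s) pr (E `&` F i `&` F j) <= (c - 1) * pr (E `&` F i) /\
   \sum_(j <- s) pr (E `&` ~` F i `&` F j) <= c * pr (E `&` ~` F i) by lra.
split.
  by apply: h1 => t [/cE + Fit]; rewrite /= asboolT// natrD lerBrDl.
by apply: h2 => t [/cE + Fit]; rewrite /= asboolF.
Qed.

(* Events are added one at a time: X i is independent of the events far from
   it, and each of the at most K near ones costs b. *)
Lemma pr_none_approx (I : eqType) (near : rel I) (X : I -> set T)
    (q b : R) (K : nat) (s : seq I) :
  0 <= b -> uniq s -> (forall i, measurable (X i)) ->
  (forall i, i \in s -> pr (X i) = q) ->
  (forall i j, i \in s -> j \in s -> i != j ->
     pr (X j `&` X i) + q ^+ 2 <= b) ->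
  (forall i, i \in s -> (count (near i) s <= K)%N) ->
  (forall i (r : seq I), i \in s -> {subset r <= s} ->
     (forall j, j \in r -> ~~ near i j) ->
     pr ([set t | forall j, j \in r -> ~ X j t] `&` X i) =
     pr [set t | forall j, j \in r -> ~ X j t] * q) ->
  `|pr [set t | forall j, j \in s -> ~ X j t] - (1 - q) ^+ size s|
    <= (size s)%:R * (K%:R * b).
Proof.
pose N (r : seq I) := [set t | forall j, j \in r -> ~ X j t].
move=> b0 + mX; have mN r : measurable (N r).
  elim: r => [|i r IHr]; first by rewrite (_ : N _ = setT)// -subTset.
  rewrite (_ : N _ = ~` X i `&` N r).
    by apply: measurableI => //; exact: measurableC.
  apply/seteqP; split=> [t Nt|t [nXi Nt] j].
    by split=> [|j jr]; apply: Nt; rewrite inE ?eqxx// jr orbT.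
  by rewrite inE => /predU1P[->//|/Nt].
rewrite -/(N s); elim: s => [|i s IHs] /=.
  move=> _ _ _ _ _; rewrite (_ : N _ = setT); last by rewrite -subTset.
  by rewrite pr_setT expr0 subrr normr0 mul0r.
move=> /andP[is_ us] Xq Xb nearK indep.
have {}IHs := IHs us.
have sub j : j \in s -> j \in i :: s by rewrite inE orbC => ->.
have Nsub r1 r2 : {subset r1 <= r2} -> N r2 `<=` N r1.
  by move=> r12 t N2 j /r12/N2.
have ii : i \in i :: s by rewrite inE eqxx.
have {}IHs : `|pr (N s) - (1 - q) ^+ size s| <= (size s)%:R * (K%:R * b).
  apply: IHs.
  - by move=> j /sub; exact: Xq.
  - by move=> j k /sub js /sub; exact: Xb.
  - by move=> j /sub/nearK; apply: leq_trans; rewrite leq_addl.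
  - move=> j r /sub js rs; apply: indep => // k /rs; exact: sub.
(* [N s] and [N far] differ only through the close events, and [X i] is independent of [N far].
   Comparing through [N far] bounds the gap between [pr (N s]&[X i)] and [pr (N s) * q] from both
   sides. *)
pose far := [seq j <- s | ~~ near i j].
pose close := [seq j <- s | near i j].
have farE : pr (N far `&` X i) = pr (N far) * q.
  apply: indep => // j; rewrite mem_filter => /andP[]//.
  by move=> _ /sub.
have NNf : pr (N s) <= pr (N far).
  by apply: pr_le => //; apply: Nsub => j; rewrite mem_filter => /andP[].
have far_close t : N far t -> N s t \/ exists2 j, j \in close & X j t.
  move=> Nft; have [[j jc Xj]|nex] := pselect (exists2 j, j \in close & X j t).
    by right; exists j.
  left=> j js Xj; have [ij|ij] := boolP (near i j).
    by apply: nex; exists j => //; rewrite mem_filter ij.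
  by apply: (Nft j) => //; rewrite mem_filter ij.
have q0 : 0 <= q by rewrite -(Xq i)// pr_ge0.
pose k := (size close)%:R : R.
have NfN : pr (N far) <= pr (N s) + k * q.
  rewrite (prID (A := N far) (B := N s))//; apply: lerD.
    by apply: pr_le => //; first exact: measurableI.
  apply: (le_trans (pr_bigU_le (s := close) (F := X) _ _ _)) => //.
  - by apply: measurableI => //; exact: measurableC.
  - by move=> t [/far_close[]].
  rewrite [leLHS]big_seq (eq_bigr (fun=> q)); last first.
    by move=> j; rewrite mem_filter => /andP[_ /sub]; exact: Xq.
  by rewrite -big_seq big_const_seq count_predT iter_addr_0 mulr_natl.
have NX : pr (N s `&` X i) <= pr (N far) * q.
  rewrite -farE; apply: pr_le; try exact: measurableI.
  apply: setSI; apply: Nsub => j; rewrite mem_filter => /andP[]//.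
have NX' : pr (N far) * q <= pr (N s `&` X i) + k * (b - q ^+ 2).
  rewrite -farE (prID (A := N far `&` X i) (B := N s))//; last exact: measurableI.
  apply: lerD.
    apply: pr_le; try by do ?apply: measurableI.
    by move=> t [[_ Xi] Ns].
  apply: (le_trans (pr_bigU_le (s := close) (F := fun j => X j `&` X i) _ _ _)) => //.
  - by apply: measurableI; [exact: measurableI|exact: measurableC].
  - by move=> j; exact: measurableI.
  - by move=> t [[/far_close[//|[j jc Xj]] Xi] _]; exists j.
  have -> : k * (b - q ^+ 2) = \sum_(j <- close) (b - q ^+ 2).
    by rewrite big_const_seq count_predT iter_addr_0 mulr_natl.
  rewrite big_seq [leRHS]big_seq; apply: ler_sum => j.
  rewrite mem_filter lerBrDr => /andP[_ js]; apply: Xb => //.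
    exact: sub.
  by apply: contraNneq is_ => ->.
have kK : k <= K%:R.
  rewrite ler_nat size_filter; apply: leq_trans (nearK i ii).
  by rewrite /= leq_addl.
have NE : pr (N (i :: s)) = pr (N s) - pr (N s `&` X i).
  rewrite (prID (A := N s) (B := X i))// addrAC subrr add0r; congr pr.
  apply/seteqP; split=> [t Nt|t [Nt nXi] j].
    by split; [move=> j /sub /Nt|exact: Nt].
  by rewrite inE => /predU1P[->//|/Nt].
have q1 : q <= 1 by rewrite -(Xq i)// pr_le1.
have k0 : 0 <= k by rewrite /k.
have kb : k * b <= K%:R * b by exact: ler_wpM2r.
rewrite exprS NE.
set e := (1 - q) ^+ size s in IHs *.
(* The old error is multiplied by [1 - q <= 1]; the second summand is the new error, at most [k * b]
   in absolute value. *)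
have -> : pr (N s) - pr (N s `&` X i) - (1 - q) * e =
  (1 - q) * (pr (N s) - e) + (q * pr (N s) - pr (N s `&` X i)) by ring.
apply: (le_trans (ler_normD _ _)).
rewrite -natr1 [leRHS]mulrDl mul1r; apply: lerD.
  rewrite normrM ger0_norm ?subr_ge0//.
  by apply: le_trans IHs; rewrite ler_piMl// gerBl.
have h : (pr (N far) - pr (N s)) * q <= k * q * q by rewrite ler_wpM2r// lerBlDl.
have h' : 0 <= (pr (N far) - pr (N s)) * q by rewrite mulr_ge0// subr_ge0.
have h3 : 0 <= k * q * q by rewrite !mulr_ge0.
have h4 : 0 <= pr (N s `&` X i) by exact: pr_ge0.
(* [Xb] gives [q ^+ 2 <= b] only when a close [j] exists, hence the detour through a sum over
   [close]. *)
have kqb : k * q ^+ 2 <= k * b.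
  have kE (c : R) : k * c = \sum_(j <- close) c.
    by rewrite big_const_seq count_predT iter_addr_0 mulr_natl.
  rewrite !kE big_seq [leRHS]big_seq; apply: ler_sum => j.
  rewrite mem_filter => /andP[_ js]; apply: le_trans (Xb j i _ _ _) => //.
  - by rewrite lerDr pr_ge0.
  - exact: sub.
  - by apply: contraNneq is_ => <-.
have qE : k * q * q = k * q ^+ 2 by rewrite expr2 mulrA.
have h5 : pr (N s) * q <= pr (N far) * q by exact: ler_wpM2r.
rewrite mulrBr in NX'; rewrite mulrBl in h.
rewrite ler_norml; apply/andP; split; rewrite (mulrC q); lra.
Qed.
End RealProbability.

(** * Events depending on finitely many sites: measurability, independence, translation
    invariance *)

Section FiniteRange.
Context {R : realType} {d : nat}.
Variables (P : probability (config d) R) (p : R).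
Hypothesis perc : site_percolation p P.
Implicit Types (x y : site d) (w : config d) (E F : set (config d)).
Implicit Types (J K : seq (site d)).

(** One implication is enough, since agreement on [J] is symmetric. [J] may repeat sites, so the
    inductions run on [size (undup J)]. *)
Definition depends J E :=
  forall w w', {in J, w =1 w'} -> E w -> E w'.

(** Stands in for conditioning on the state of [x]: an event and its preimage under [update x b]
    agree where [w x = b], and the preimage no longer depends on [x]. This drives the inductions on
    the number of sites. *)
Definition update x (b : bool) w : config d := fun y => if y == x then b else w y.

Definition translate (a : site d) w : config d := fun y => w (y + a).

Lemma dependsI J K E F : depends J E -> depends K F -> depends (J ++ K) (E `&` F).
Proof.
move=> dE dF w w' ww' [Ew Fw]; split.
  by apply: dE Ew => x xJ; apply: ww'; rewrite mem_cat xJ.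
by apply: dF Fw => x xK; apply: ww'; rewrite mem_cat xK orbT.
Qed.

Lemma depends_update J x b E : depends J E ->
  depends (rem x (undup J)) (update x b @^-1` E).
Proof.
move=> dE w w' ww'; apply: dE => y yJ; rewrite /update.
have [//|yx] := eqVneq y x; apply: ww'.
by rewrite mem_rem_uniq ?undup_uniq// !inE yx mem_undup.
Qed.
Arguments depends_update {J} x b {E} _.

Lemma update_indep J x b E : depends J E -> x \notin J -> update x b @^-1` E = E.
Proof.
move=> dE xJ; apply/seteqP; split=> w; apply: dE => y yJ; rewrite /update;
  by case: eqVneq => // yx; rewrite -yx yJ in xJ.
Qed.

Lemma update_id w x b : w x = b -> update x b w = w.
Proof. by move=> <-; apply/funext => y; rewrite /update; case: eqVneq => [->|]. Qed.
Arguments update_id {w x b} _.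

Lemma measurable_occupied x : measurable [set w : config d | w x].
Proof. by apply: sub_sigma_algebra; exists x. Qed.

Lemma depends_measurable J E : depends J E -> measurable E.
Proof.
move: J E; suff H n J E : size (undup J) = n -> depends J E -> measurable E.
  by move=> J E; exact: H.
elim: n J E => [|n IHn] J E sJ dE.
  have J0 x : x \in J = false by rewrite -mem_undup (size0nil sJ).
  have [->|/set0P[w Ew]] := eqVneq E set0; first exact: measurable0.
  rewrite (_ : E = setT)// -subTset => w' _; apply: dE Ew => x.
  by rewrite J0.
case uJ : (undup J) sJ => [//|x K] [sK].
have -> : E = (update x true @^-1` E `&` [set w : config d | w x]) `|`
              (update x false @^-1` E `&` ~` [set w : config d | w x]).
  apply/seteqP; split=> [w Ew|w [[/= + wx]|[/= + /negP/negbTE wx]]].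
  - by case wx : (w x); [left|right]; split; rewrite /= ?wx// update_id.
  - by rewrite update_id.
  - by rewrite update_id.
have mb b : measurable (update x b @^-1` E).
  apply: (IHn _ _ _ (depends_update x b dE)); rewrite uJ /= eqxx undup_id//.
  by have := undup_uniq J; rewrite uJ => /andP[].
have mx := measurable_occupied x.
apply: measurableU; apply: measurableI => //; exact: measurableC.
Qed.

Definition cylinder K w : set (config d) := [set w' : config d | {in K, w' =1 w}].

Lemma cylinder_depends K w : depends K (cylinder K w).
Proof. by move=> w1 w2 w12 h x xK; rewrite -w12// h. Qed.

Let bern (b : bool) : R := if b then p else 1 - p.

Lemma pr_site x (b : bool) : pr P [set w | w x = b] = bern b.
Proof.
have prx : pr P [set w : config d | w x] = p by rewrite /pr perc.2.
case: b => //=; rewrite -[in RHS]prx -prC; last exact: measurable_occupied.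
by congr pr; apply/seteqP; split=> w /=; case: (w x).
Qed.

Lemma pr_cylinder K w : uniq K -> pr P (cylinder K w) = \prod_(x <- K) bern (w x).
Proof.
move=> uK; have := perc.1 [fset x in K]%fset (fun x => [set w x]).
rewrite -/(pr P _) (_ : \bigcap_(_ in _) _ = cylinder K w).
  move=> ->; rewrite (perm_big K); last first.
    by apply: uniq_perm => [|//|x]; [exact: fset_uniq|rewrite !inE].
  by apply: eq_bigr => x _; exact: (pr_site x (w x)).
apply/seteqP; split=> w' /= h x xK; apply: h; move: xK; rewrite /= !inE//.
Qed.

(** The sites of [J] move one by one from [F] into the cylinder, until [F] is trivial and the
    product rule of [perc] applies. *)
Lemma pr_cylinderI n J K w F : size (undup J) = n -> depends J F -> uniq K ->
  (forall x, x \in J -> x \notin K) ->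
  pr P (cylinder K w `&` F) = \prod_(x <- K) bern (w x) * pr P F.
Proof.
elim: n J K w F => [|n IHn] J K w F sJ dF uK JK.
  have J0 x : x \in J = false by rewrite -mem_undup (size0nil sJ).
  have [->|/set0P[w' Fw]] := eqVneq F set0; first by rewrite setI0 pr_set0 mulr0.
  rewrite (_ : F = setT) ?setIT ?pr_setT ?mulr1 ?pr_cylinder// -subTset => w2 _.
  by apply: dF Fw => x; rewrite J0.
case uJ : (undup J) sJ => [//|x J'] [sJ'].
have xJ : x \in J by rewrite -mem_undup uJ inE eqxx.
have step K' w' : uniq K' -> (forall y, y \in J -> y \notin K') ->
    pr P (cylinder K' w' `&` F) = \prod_(x <- K') bern (w' x) *
    (p * pr P (update x true @^-1` F) + (1 - p) * pr P (update x false @^-1` F)).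
  move=> uK' JK'.
  have xK' := JK' x xJ.
  have half b : pr P (cylinder K' w' `&` F `&` [set w | w x = b]) =
      bern b * \prod_(x <- K') bern (w' x) * pr P (update x b @^-1` F).
    have -> : cylinder K' w' `&` F `&` [set w | w x = b] =
        cylinder (x :: K') (update x b w') `&` (update x b @^-1` F).
      apply/seteqP; split=> [w1 [[cw1 Fw1] /= w1x]|w1 [cw1 /= Fw1]].
        split; last by rewrite /= update_id.
        move=> y; rewrite inE /update => /predU1P[->|yK]; first by rewrite eqxx.
        by case: eqVneq => [->//|_]; exact: cw1.
      have w1x : w1 x = b by rewrite cw1 ?inE ?eqxx// /update eqxx.
      rewrite update_id// in Fw1; split=> //; split=> // y yK.
      rewrite cw1 ?inE ?yK ?orbT// /update.
      by case: eqVneq => // yx; rewrite -yx yK in xK'.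
    rewrite (IHn _ _ _ _ _ (depends_update x b dF)) /=.
    - rewrite big_cons {1}/update eqxx; congr (_ * _ * _).
      rewrite big_seq [RHS]big_seq; apply: eq_bigr => y yK; rewrite /update.
      by case: eqVneq => // yx; rewrite -yx yK in xK'.
    - rewrite uJ /= eqxx undup_id//.
      by have := undup_uniq J; rewrite uJ => /andP[].
    - by rewrite xK'.
    - move=> y; rewrite mem_rem_uniq ?undup_uniq// !inE mem_undup => /andP[yx yJ].
      by rewrite negb_or yx JK'.
  rewrite (prID P (B := [set w | w x = true])).
  - rewrite half (_ : ~` _ = [set w | w x = false]); first by rewrite half /=; ring.
    by apply/seteqP; split=> w2 /=; case: (w2 x).
  - apply: (@depends_measurable (K' ++ J)); apply: dependsI => //.
    exact: cylinder_depends.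
  - exact: measurable_occupied.
(* With no prescribed site, [step] expands [pr P F] itself as the average over the state of [x]; the
   same average appears in [step] for [K]. *)
have := step [::] w isT (fun _ _ => isT).
rewrite big_nil mul1r (_ : cylinder [::] w `&` F = F); first by move=> ->; exact: step.
by rewrite setIidr// => w' _ x.
Qed.

Lemma pr_update J x F : depends J F ->
  pr P F = p * pr P (update x true @^-1` F) + (1 - p) * pr P (update x false @^-1` F).
Proof.
move=> dF.
have half b : pr P (F `&` [set w | w x = b]) = bern b * pr P (update x b @^-1` F).
  have -> : F `&` [set w | w x = b] =
      cylinder [:: x] (fun=> b) `&` update x b @^-1` F.
    apply/seteqP; split=> [w [Fw /= wx]|w [/(_ x) + /=]].
      by split=> [y|]; rewrite /= ?update_id// inE => /eqP ->.
    by rewrite inE eqxx => /(_ isT) wx; rewrite update_id.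
  rewrite (pr_cylinderI _ erefl (depends_update x b dF)) ?big_seq1//.
  by move=> y; rewrite mem_rem_uniq ?undup_uniq// !inE => /andP[].
rewrite (prID P (B := [set w | w x = true])).
- rewrite half (_ : ~` _ = [set w | w x = false]); first by rewrite half.
  by apply/seteqP; split=> w2 /=; case: (w2 x).
- exact: depends_measurable dF.
- exact: measurable_occupied.
Qed.
Arguments pr_update {J} x {F} _.

(** Averaging over a site of [J] changes only [E], since [F] does not see that site; so [E] can be
    stripped of its sites one by one. *)
Lemma prI J K E F : depends J E -> depends K F -> (forall x, x \in J -> x \notin K) ->
  pr P (E `&` F) = pr P E * pr P F.
Proof.
move=> dE dF; move: dE; move En : (size (undup J)) => n.
elim: n J E En => [|n IHn] J E sJ dE JK.
  have J0 x : x \in J = false by rewrite -mem_undup (size0nil sJ).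
  have [->|/set0P[w' Ew]] := eqVneq E set0; first by rewrite set0I pr_set0 mul0r.
  rewrite (_ : E = setT) ?setTI ?pr_setT ?mul1r// -subTset => w2 _.
  by apply: dE Ew => x; rewrite J0.
case uJ : (undup J) sJ => [//|x J'] [sJ'].
have xJ : x \in J by rewrite -mem_undup uJ inE eqxx.
rewrite (pr_update x (dependsI dE dF)) (pr_update x dE) !preimage_setI.
rewrite !(update_indep _ dF (JK x xJ)).
have H b : pr P (update x b @^-1` E `&` F) = pr P (update x b @^-1` E) * pr P F.
  apply: (IHn _ _ _ (depends_update x b dE)).
    rewrite uJ /= eqxx undup_id//.
    by have := undup_uniq J; rewrite uJ => /andP[].
  by move=> y; rewrite mem_rem_uniq ?undup_uniq// !inE mem_undup => /andP[_ /JK].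
rewrite !H; ring.
Qed.

Lemma depends_translate J a E : depends J E ->
  depends [seq x + a | x <- J] (translate a @^-1` E).
Proof. by move=> dE w w' ww'; apply: dE => x xJ; apply: ww'; exact: map_f. Qed.
Arguments depends_translate {J} a {E} _.

(** Fixing the site [x + a] in the translated event amounts to fixing [x] in [E], and all sites have
    the same law, so both sides expand alike. *)
Lemma pr_translate J a E : depends J E -> pr P (translate a @^-1` E) = pr P E.
Proof.
move=> dE; move: J E dE; suff H (n : nat) J E : size (undup J) = n -> depends J E ->
    pr P (translate a @^-1` E) = pr P E by move=> J E; exact: H.
elim: n J E => [|n IHn] J E sJ dE.
  have J0 x : x \in J = false by rewrite -mem_undup (size0nil sJ).
  have [->|/set0P[w' Ew]] := eqVneq E set0; first by rewrite preimage_set0.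
  rewrite (_ : E = setT) ?preimage_setT// -subTset => w2 _.
  by apply: dE Ew => x; rewrite J0.
case uJ : (undup J) sJ => [//|x J'] [sJ'].
rewrite (pr_update (x + a) (depends_translate a dE)) (pr_update x dE).
have H b : pr P (update (x + a) b @^-1` (translate a @^-1` E)) =
    pr P (update x b @^-1` E).
  rewrite -(IHn _ _ _ (depends_update x b dE)).
    congr pr; apply/seteqP; split=> w /=;
    congr E; apply/funext => y; rewrite /update /translate (inj_eq (addIr a))//.
  rewrite uJ /= eqxx undup_id//.
  by have := undup_uniq J; rewrite uJ => /andP[].
by rewrite !H.
Qed.
Arguments pr_translate {J} a {E} _.

End FiniteRange.

(** * The lexicographic order on sites *)

Section LexicographicOrder.
Context {d : nat}.
Implicit Types x y z a : site d.

Lemma lex_le_refl x : lex_le x x.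
Proof. exact: lexx. Qed.

Lemma lex_le_trans x y z : lex_le x y -> lex_le y z -> lex_le x z.
Proof. exact: le_trans. Qed.

Lemma lex_le_total x y : lex_le x y || lex_le y x.
Proof. exact: le_total. Qed.

Lemma lex_le_anti x y : lex_le x y -> lex_le y x -> x = y.
Proof.
move=> xy yx.
have /(congr1 (fun t => tnth t)) e : [tuple x 0 i | i < d] = [tuple y 0 i | i < d].
  by apply: (@le_anti _ (d.-tuplelexi int)); apply/andP.
by apply/rowP => i; have := congr1 (@^~ i) e; rewrite !tnth_mktuple.
Qed.

Lemma lex_leDr a x y : lex_le x y -> lex_le (x + a) (y + a).
Proof.
move=> /lexi_tupleP[k h]; apply/lexi_tupleP; exists k => i /h.
rewrite !tnth_mktuple !mxE => -[le_xy eq_xy]; split; first by rewrite lerD2r.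
by rewrite -eq_xy (inj_eq (addIr _)).
Qed.

Lemma seq_left_endpoint x (s : seq (site d)) : x \in s ->
  exists2 y, y \in s & {in s, forall z, lex_le y z}.
Proof.
elim: s x => [//|a [|b s] IHs] x _.
  by exists a => [|z]; rewrite inE// => /eqP ->; exact: lex_le_refl.
have [y ys ymin] := IHs b (mem_head _ _).
have [ay|ya] := orP (lex_le_total a y).
  exists a; rewrite ?mem_head// => z; rewrite inE => /predU1P[->|/ymin].
    exact: lex_le_refl.
  exact: lex_le_trans.
exists y; first by rewrite inE ys orbT.
by move=> z; rewrite inE => /predU1P[->|/ymin].
Qed.

End LexicographicOrder.

(** * Sup-norm distance and boxes *)

Section Boxes.
Context {d : nat}.
Implicit Types x y z a : site d.

(** The sup norm makes balls into cubes with exactly [(2 * r).+1 ^ d] sites; a nearest-neighbour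
    step moves by at most 1 in it. *)
Definition within (r : nat) x y : bool := [forall i, `|y 0 i - x 0 i| <= r%:Z].

Lemma withinP r x y : reflect (forall i, `|y 0 i - x 0 i| <= r%:Z) (within r x y).
Proof. exact: forallP. Qed.

Lemma within_refl x : within 0 x x.
Proof. by apply/withinP => i; rewrite subrr normr0. Qed.

Lemma within_sym r x y : within r x y = within r y x.
Proof. by apply: eq_forallb => i; rewrite distrC. Qed.

Lemma within_trans r s x y z : within r x y -> within s y z -> within (r + s) x z.
Proof.
move=> /withinP xy /withinP yz; apply/withinP => i.
have -> : z 0 i - x 0 i = (z 0 i - y 0 i) + (y 0 i - x 0 i) by rewrite addrA subrK.
by rewrite PoszD addrC; apply: le_trans (ler_normD _ _) _; rewrite lerD.
Qed.

Lemma within_le r s x y : (r <= s)%N -> within r x y -> within s x y.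
Proof.
move=> rs /withinP xy; apply/withinP => i; apply: le_trans (xy i) _.
by rewrite lez_nat.
Qed.

Lemma withinD r a x y : within r (x + a) (y + a) = within r x y.
Proof. by apply: eq_forallb => i; rewrite !mxE opprD addrACA subrr addr0. Qed.

Lemma in_boxE n x : in_box n x = within n 0 x.
Proof. by apply: eq_forallb => i; rewrite mxE subr0. Qed.

Lemma neighbour_sym x y : neighbour x y = neighbour y x.
Proof.
by rewrite /neighbour; under eq_bigr do rewrite distrC.
Qed.

Lemma neighbourD a x y : neighbour (x + a) (y + a) = neighbour x y.
Proof.
rewrite /neighbour; congr (_ == _); apply: eq_bigr => i _.
by rewrite !mxE opprD addrACA subrr addr0.
Qed.

Lemma neighbour_within x y : neighbour x y -> within 1 x y.
Proof.
move=> /eqP xy; apply/withinP => i; rewrite distrC -[1%:Z]/(1 : int) -xy (bigD1 i)//= lerDl.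
by apply: sumr_ge0.
Qed.

Lemma path_within x s : path (@neighbour d) x s -> within (size s) x (last x s).
Proof.
elim: s x => [|y s IHs] x /=; first by rewrite within_refl.
by move=> /andP[/neighbour_within xy /IHs]; exact: (within_trans xy).
Qed.

Definition box (r : nat) x : seq (site d) :=
  [seq x + \row_i ((f i)%:Z - r%:Z) | f : {ffun 'I_d -> 'I_(2 * r).+1}].

Lemma mem_box r x y : (y \in box r x) = within r x y.
Proof.
apply/mapP/withinP => [[f _ ->] i|xy].
  rewrite !mxE addrAC subrr add0r ler_norml; have := ltn_ord (f i).
  by move: (nat_of_ord (f i)) => k; lia.
have xy0 (i : 'I_d) : 0 <= y 0 i - x 0 i + r%:Z <= (2 * r)%N%:Z.
  by have := xy i; rewrite ler_norml; lia.
have f_lt (i : 'I_d) : (absz (y 0 i - x 0 i + r%:Z)%R < (2 * r).+1)%N.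
  by have := xy0 i; lia.
exists [ffun i => Ordinal (f_lt i)]; first by rewrite mem_enum.
apply/rowP => i; rewrite !mxE ffunE /= gez0_abs; last by have := xy0 i; lia.
by rewrite addrK addrC subrK.
Qed.

Lemma box_uniq r x : uniq (box r x).
Proof.
rewrite map_inj_uniq ?enum_uniq// => f g /addrI/rowP fg.
apply/ffunP => i; have := fg i; rewrite !mxE => /addIr[]; exact: val_inj.
Qed.

Lemma size_box r x : size (box r x) = ((2 * r).+1 ^ d)%N.
Proof. by rewrite size_map -cardE card_ffun !card_ord. Qed.

End Boxes.

(** * Sets with at least n elements *)

Section Cardinality.
Context {T : choiceType}.
Implicit Types A B : set T.

(** A list form of the cardinal comparison in [cluster0_ge]: it also covers infinite clusters, and
    its negation yields finiteness. *)
Definition at_least (n : nat) A : Prop :=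
  exists s : seq T, [/\ uniq s, size s = n & forall x, x \in s -> A x].

Lemma at_least_sub n A B : A `<=` B -> at_least n A -> at_least n B.
Proof. by move=> AB [s [us sn sA]]; exists s; split=> // x /sA/AB. Qed.

Lemma at_least_leq m n A : (m <= n)%N -> at_least n A -> at_least m A.
Proof.
move=> mn [s [us sn sA]]; exists (take m s); split; first exact: take_uniq.
  by rewrite size_takel// sn.
by move=> x /mem_take/sA.
Qed.

Lemma at_leastN_fset n A : ~ at_least n A ->
  exists2 F : {fset T}, A = [set` F] & (#|` F| < n)%N.
Proof.
move=> nA; have [finA|infA] := pselect (finite_set A).
  exists (fset_set A); first by rewrite fset_setK.
  rewrite ltnNge; apply/negP => /at_least_leq; apply: contra_not nA; apply.
  exists (fset_set A); split; [exact: fset_uniq|by []|move=> x].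
  by rewrite in_fset_set// inE.
have [F FA Fn] := infinite_set_fset n infA.
exfalso; apply: nA; apply: (at_least_leq Fn); exists F; split=> //.
Qed.

Lemma at_least_fset n (F : {fset T}) : at_least n [set` F] <-> (n <= #|` F|)%N.
Proof.
split=> [[s [us <- sF]]|nF]; first exact: uniq_leq_size.
by apply: at_least_leq nF _; exists F; split=> //; exact: fset_uniq.
Qed.

Lemma at_least_card n A : (`I_n #<= A)%card <-> at_least n A.
Proof.
have cardF (F : {fset T}) : ([set` F] #= `I_#|` F|)%card by exact/card_eq_fsetP.
split=> [nA|[s [us <- sA]]].
  apply: contrapT => /[dup] natA /at_leastN_fset[F AF Fn].
  move: nA; rewrite AF => /card_le_trans h; have := cardF F; rewrite card_eq_le => /andP[/h].
  by rewrite card_le_II leqNgt Fn.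
have := cardF [fset x in s]%fset; rewrite card_eq_le => /andP[_].
rewrite card_fseq undup_id// => /card_le_trans; apply.
by apply: subset_card_le => x /=; rewrite inE; exact: sA.
Qed.

End Cardinality.

(** * Deterministic properties of clusters: paths, locality, translation, left endpoints *)

Section Clusters.
Context {d : nat}.
Implicit Types (x y z a : site d) (w v : site d -> bool) (D : pred (site d)).

Definition restrict D w : site d -> bool := fun x => D x && w x.

Lemma restrict_boxE n w : restrict_box n w = restrict (within n 0) w.
Proof. by apply/funext => x; rewrite /restrict_box in_boxE. Qed.

Lemma cluster_occupied w x y : site_cluster w x y -> w y.
Proof. by move=> [A [_ + _] Ay]; exact. Qed.

Lemma clusterP w x y : site_cluster w x y <->
  w x /\ exists s, [/\ path (@neighbour d) x s, last x s = y & all w s].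
Proof.
split=> [[A [Ax Aw Acon] Ay]|[wx [s [xs <- sw]]]].
  split; first exact: Aw; have [s [xs sy sA]] := Acon _ _ Ax Ay.
  by exists s; split=> //; apply/allP => z /sA/Aw.
(* The set of reachable sites is itself one of the sets in the union: two of its points are joined
   through [x], by reversing one path and appending the other. *)
pose A := [set z | exists s, [/\ path (@neighbour d) x s, last x s = z & all w s]].
have rA r z : path (@neighbour d) z r -> all w r -> A z ->
    A (last z r) /\ forall u, u \in r -> A u.
  elim: r z => [|u r IHr] z //= /andP[zu ur] /andP[wu wr] [t [xt tz wt]].
  have Au : A u.
    exists (rcons t u); rewrite rcons_path last_rcons all_rcons xt tz zu wu.
    by split.
  have [Al Ar] := IHr u ur wr Au; split=> // u'.
  by rewrite inE => /predU1P[->//|/Ar].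
have Ax : A x by exists [::].
have back r z : path (@neighbour d) x r -> last x r = z -> all w r ->
    exists t, [/\ path (@neighbour d) z t, last z t = x & all w t].
  move=> xr <- wr; exists (rev (belast x r)); split.
  - rewrite rev_path (eq_path (e' := @neighbour d))// => u v; exact: neighbour_sym.
  - by case: r {xr wr} => //= u r; rewrite rev_cons last_rcons.
  - rewrite all_rev; apply/allP => u /mem_belast.
    by rewrite inE => /predU1P[->//|]; apply/allP.
exists A; last by exists s.
split=> // [z [t [xt <- wt]]|u z [t [xt tu wt]] [r [xr rz wr]]].
  by have := mem_last x t; rewrite inE => /predU1P[->//|]; exact: (allP wt).
have [t' [yt' t'x wt']] := back _ _ xt tu wt.
have [_ t'A] : A (last u t') /\ forall u', u' \in t' -> A u'.
  by apply: rA => //; exists t.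
have [_ rA'] := rA r x xr wr Ax.
exists (t' ++ r); rewrite cat_path yt' t'x last_cat t'x xr; split=> // u'.
by rewrite mem_cat => /orP[/t'A|/rA'].
Qed.

Lemma cluster_refl w x : w x -> site_cluster w x x.
Proof. by move=> wx; apply/clusterP; split=> //; exists [::]. Qed.

Lemma cluster_root w x y : site_cluster w x y -> w x.
Proof. by move=> /clusterP[]. Qed.

Lemma cluster_step w x y z :
  site_cluster w x y -> neighbour y z -> w z -> site_cluster w x z.
Proof.
move=> /clusterP[wx [s [xs sy ws]]] yz wz; apply/clusterP; split=> //.
by exists (rcons s z); rewrite rcons_path sy last_rcons all_rcons wz xs ws; split.
Qed.

Lemma cluster_ind w x (S : set (site d)) : S x ->
  (forall y z, site_cluster w x y -> S y -> neighbour y z -> w z -> S z) ->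
  site_cluster w x `<=` S.
Proof.
move=> Sx Sstep y /clusterP[wx [s [xs <- ws]]].
suff H r z : path (@neighbour d) z r -> all w r -> site_cluster w x z -> S z ->
    S (last z r) by apply: H => //; exact: cluster_refl.
elim: r z => [|u r IHr] z //= /andP[zu ur] /andP[wu wr] Cz Sz.
by apply: IHr => //; [exact: cluster_step zu wu|exact: Sstep zu wu].
Qed.

Lemma cluster_trans w x y z :
  site_cluster w x y -> site_cluster w y z -> site_cluster w x z.
Proof.
move=> xy; apply: cluster_ind => // u v _ xu uv wv.
exact: (cluster_step _ uv wv).
Qed.

Lemma cluster_sym w x y : site_cluster w x y -> site_cluster w y x.
Proof.
move=> xy; have wx := cluster_root xy; move: y xy.
apply: cluster_ind; first exact: cluster_refl.
move=> y z _ yx yz wz; apply: cluster_trans (yx).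
apply: (cluster_step (cluster_refl wz)); last exact: cluster_root yx.
by rewrite neighbour_sym.
Qed.

Lemma cluster_eq w x y : site_cluster w x y -> site_cluster w y = site_cluster w x.
Proof.
move=> xy; apply/seteqP; split=> z; first exact: cluster_trans.
by apply: cluster_trans; exact: cluster_sym.
Qed.

Lemma cluster_vacant w x : ~~ w x -> site_cluster w x = set0.
Proof. by move=> wx; rewrite -subset0 => y /cluster_root; exact/negP. Qed.

Lemma cluster_mono w v x : (forall y, w y -> v y) ->
  site_cluster w x `<=` site_cluster v x.
Proof.
move=> wv y xy; have wx := cluster_root xy; move: y xy; apply: cluster_ind.
  exact/cluster_refl/wv.
by move=> y z _ xy yz /wv; exact: (cluster_step xy yz).
Qed.

Lemma cluster_restrict D w x : site_cluster (restrict D w) x `<=` site_cluster w x.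
Proof. by apply: cluster_mono => y /andP[]. Qed.

(** A path leaving [D] would first have to step from the confined cluster to a neighbour outside
    [D]. *)
Lemma cluster_confined D w x : D x ->
  (forall y z, site_cluster (restrict D w) x y -> neighbour y z -> D z) ->
  site_cluster w x = site_cluster (restrict D w) x.
Proof.
move=> Dx Dnb; apply/seteqP; split; last exact: cluster_restrict.
move=> y xy; have wx := cluster_root xy; move: y xy; apply: cluster_ind.
  by apply: cluster_refl; rewrite /restrict Dx.
move=> y z _ xy yz wz; apply: (cluster_step xy yz).
by rewrite /restrict wz (Dnb y).
Qed.

(** A repetition-free path with k steps visits k + 1 sites of the cluster, so distance is paid for
    in size. *)
Lemma cluster_path w x y : site_cluster w x y -> exists2 k, within k x y &
  at_least k.+1 (site_cluster w x).
Proof.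
move=> xy; have : exists s, [/\ path (@neighbour d) x s, last x s = y &
    forall z, z \in s -> site_cluster w x z].
  have wx := cluster_root xy; move: y xy; apply: cluster_ind.
    by exists [::].
  move=> y z xy [s [xs sy sC]] yz wz; exists (rcons s z).
  rewrite rcons_path xs sy last_rcons; split=> // u.
  rewrite mem_rcons inE => /predU1P[->|/sC//].
  exact: (cluster_step xy yz).
move=> [s [xs]]; case/shortenP: xs => t xt ut ts <- sC.
exists (size t); first exact: path_within.
exists (x :: t); split=> // z; rewrite inE => /predU1P[->|/ts/sC//].
exact/cluster_refl/(cluster_root xy).
Qed.

Lemma cluster_within L w x y : ~ at_least L (site_cluster w x) ->
  site_cluster w x y -> within L.-2 x y.
Proof.
move=> nL /cluster_path[k xy kC]; apply: within_le xy.
by case: (leqP L k.+1) => [/at_least_leq/(_ kC)//|]; lia.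
Qed.

Lemma cluster_root_within L w x : ~ at_least L (site_cluster w x) -> w x -> (1 < L)%N.
Proof.
move=> nL wx; rewrite ltnNge; apply/negP => L1; apply: nL.
apply: at_least_leq L1 _; exists [:: x]; split=> // z; rewrite inE => /eqP ->.
exact: cluster_refl.
Qed.

(** The restricted cluster reaches distance at most [L - 2] and its neighbours one more, so it stays
    clear of the complement of [D]. Smallness is asked of the restricted cluster, which lets
    [small_cluster_local] pass to a second configuration. *)
Lemma small_cluster_restrict (D : pred (site d)) L w x :
  (forall y, within L x y -> D y) ->
  ~ at_least L (site_cluster (restrict D w) x) ->
  site_cluster w x = site_cluster (restrict D w) x.
Proof.
move=> LD nL; apply: cluster_confined.
  by apply/LD/(within_le _ (within_refl x)).
move=> y z xy yz; apply: LD.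
have L1 := cluster_root_within nL (cluster_root xy).
apply: (within_le _ (within_trans (cluster_within nL xy) (neighbour_within yz))).
lia.
Qed.

Lemma small_cluster_local L w v x :
  (forall y, within L x y -> w y = v y) -> ~ at_least L (site_cluster w x) ->
  site_cluster v x = site_cluster w x.
Proof.
move=> wv nL.
have wvE : restrict (within L x) w = restrict (within L x) v.
  apply/funext => y; rewrite /restrict; case: (boolP (within L x y)) => //= xy.
  exact: wv.
have nLw : ~ at_least L (site_cluster (restrict (within L x) w) x).
  by apply: contra_not nL; apply: at_least_sub; exact: cluster_restrict.
rewrite [in RHS](small_cluster_restrict _ nLw)//.
by rewrite wvE in nLw *; exact: small_cluster_restrict nLw.
Qed.

(** By contraposition: a cluster of [v] with fewer than [L] sites would be the same in [w]. *)
Lemma at_least_local L w v x :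
  (forall y, within L x y -> w y = v y) ->
  at_least L (site_cluster w x) -> at_least L (site_cluster v x).
Proof.
move=> wv wL; apply: contrapT => vL.
by apply: (vL); rewrite -(small_cluster_local (v := w) _ vL)// => y /wv.
Qed.

Lemma cluster_translate a w x y :
  site_cluster (fun z => w (z + a)) x y <-> site_cluster w (x + a) (y + a).
Proof.
have half b v u z :
    site_cluster (fun t => v (t + b)) u z -> site_cluster v (u + b) (z + b).
  move=> uz; have wu := cluster_root uz; move: z uz.
  apply: (cluster_ind (S := [set z | site_cluster v (u + b) (z + b)])).
    exact: cluster_refl.
  move=> z t _ uz zt wt /=; apply: cluster_step uz _ wt.
  by rewrite neighbourD.
split; first exact: half.
have wE : (fun z => (fun t => w (t + a)) (z - a)) = w.
  by apply/funext => z /=; rewrite subrK.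
rewrite -[in site_cluster w _]wE.
by move=> /(half (- a) (fun t => w (t + a))); rewrite !addrK.
Qed.

Lemma at_least_translate n a w x :
  at_least n (site_cluster (fun z => w (z + a)) x) <->
  at_least n (site_cluster w (x + a)).
Proof.
split=> -[s [us sn sC]].
  exists [seq z + a | z <- s]; split; first by rewrite map_inj_uniq//; exact: addIr.
    by rewrite size_map.
  by move=> _ /mapP[z /sC xz ->]; exact/cluster_translate.
exists [seq z - a | z <- s]; split; first by rewrite map_inj_uniq//; exact: addIr.
  by rewrite size_map.
by move=> _ /mapP[z /sC xz ->]; apply/cluster_translate; rewrite subrK.
Qed.

Lemma left_endpoint_translate a w x :
  left_endpoint (site_cluster (fun z => w (z + a)) x) x <->
  left_endpoint (site_cluster w (x + a)) (x + a).
Proof.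
split=> -[xx xmin]; split; try exact/cluster_translate.
  move=> y xy; rewrite -[y](subrK a); apply/lex_leDr/xmin/cluster_translate.
  by rewrite subrK.
move=> y xy; have := xmin _ (iffLR (cluster_translate a w x y) xy).
by move=> /(lex_leDr (- a)); rewrite !addrK.
Qed.

Lemma cluster_left_endpoint L w x : ~ at_least L (site_cluster w x) -> w x ->
  exists2 y, site_cluster w x y & left_endpoint (site_cluster w y) y.
Proof.
move=> /at_leastN_fset[F FE _] wx.
have xF : x \in F by have := cluster_refl wx; rewrite FE.
have [y yF ymin] := seq_left_endpoint xF.
have xy : site_cluster w x y by rewrite FE.
exists y => //; rewrite (cluster_eq xy) FE; split=> //.
Qed.

Lemma left_endpoint_unique w x y z :
  site_cluster w x y -> site_cluster w x z ->
  left_endpoint (site_cluster w y) y -> left_endpoint (site_cluster w z) z -> y = z.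
Proof.
move=> xy xz; rewrite (cluster_eq xy) (cluster_eq xz) => -[_ ymin] [_ zmin].
by apply: lex_le_anti; [exact: ymin|exact: zmin].
Qed.

End Clusters.

Lemma uniq_count_le1 (T : eqType) (a : pred T) (s : seq T) : uniq s ->
  (forall x y, a x -> a y -> x = y) -> (count a s <= 1)%N.
Proof.
move=> us a1; rewrite -size_filter; have := filter_uniq a us.
have : all a (seq.filter a s) by exact: filter_all.
case: (seq.filter a s) => [//|x [//|y t]] /= /and3P[ax ay _].
by rewrite (a1 x y)// inE eqxx.
Qed.

(** * Cluster events under the percolation measure, and two distinct large clusters *)

Section Percolation.
Context {R : realType} {d : nat}.
Variables (P : probability (config d) R) (p : R).
Hypothesis perc : site_percolation p P.
Implicit Types (x y z : site d) (w : config d).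

Definition big_cluster (m : nat) x : set (config d) :=
  [set w : config d | at_least m (site_cluster w x)].

(** With [Q] left free, locality and measurability are settled once for all events about a truncated
    cluster. *)
Definition small_cluster (L : nat) x (Q : set (site d) -> Prop) : set (config d) :=
  [set w : config d | ~ at_least L (site_cluster w x) /\ Q (site_cluster w x)].

Definition cluster_start (m L : nat) x : set (config d) :=
  small_cluster L x (fun C => at_least m C /\ left_endpoint C x).

Lemma big_cluster_depends m x : depends (box m x) (big_cluster m x).
Proof.
move=> w w' ww'; apply: at_least_local => y xy.
by apply: ww'; rewrite mem_box.
Qed.
Arguments big_cluster_depends : clear implicits.

Lemma small_cluster_depends L x Q : depends (box L x) (small_cluster L x Q).
Proof.
move=> w w' ww' [nL Qw].
rewrite /small_cluster /= (small_cluster_local (L := L) (w := w))// => y xy.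
by apply: ww'; rewrite mem_box.
Qed.
Arguments small_cluster_depends : clear implicits.

Lemma measurable_big_cluster m x : measurable (big_cluster m x).
Proof. exact: (depends_measurable (big_cluster_depends m x)). Qed.

Lemma measurable_small_cluster L x Q : measurable (small_cluster L x Q).
Proof. exact: (depends_measurable (small_cluster_depends L x Q)). Qed.

Lemma cluster_tailE m : cluster_tail P m = pr P (big_cluster m 0).
Proof.
by congr (pr P _); apply/seteqP; split=> w /=; rewrite /cluster0_ge at_least_card.
Qed.

Lemma pr_big_cluster m x : pr P (big_cluster m x) = cluster_tail P m.
Proof.
rewrite cluster_tailE -(pr_translate perc x (big_cluster_depends m 0)).
congr pr; apply/seteqP; split=> w.
  by move=> h; apply/at_least_translate; rewrite add0r.
by move=> /at_least_translate; rewrite add0r.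
Qed.

Lemma cluster_tail_ge0 m : 0 <= cluster_tail P m.
Proof. by rewrite cluster_tailE pr_ge0. Qed.

Lemma cluster_tail_le1 m : cluster_tail P m <= 1.
Proof. by rewrite cluster_tailE pr_le1//; exact: measurable_big_cluster. Qed.

Lemma cluster_tail_le m n : (m <= n)%N -> cluster_tail P n <= cluster_tail P m.
Proof.
move=> mn; rewrite !cluster_tailE; apply: pr_le.
- exact: measurable_big_cluster.
- exact: measurable_big_cluster.
- by move=> w; exact: at_least_leq.
Qed.

Lemma cluster_start_translate m L a x w :
  cluster_start m L x (translate a w) <-> cluster_start m L (x + a) w.
Proof.
split=> -[nL [mC lx]]; split.
- by move=> h; apply: nL; exact/at_least_translate.
- by split; [exact/at_least_translate|exact/left_endpoint_translate].
- by move=> /at_least_translate.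
- by split; [exact/at_least_translate|exact/left_endpoint_translate].
Qed.
Arguments cluster_start_translate : clear implicits.

Lemma pr_cluster_start m L x : pr P (cluster_start m L x) = pr P (cluster_start m L 0).
Proof.
rewrite -(pr_translate perc x (small_cluster_depends L 0 _)).
congr pr; apply/seteqP; split=> w.
  by move=> h; apply/(cluster_start_translate m L x 0 w); rewrite add0r.
by move=> /(cluster_start_translate m L x 0 w); rewrite add0r.
Qed.

(* Given C(x) = A, the cluster of a site outside A only uses sites that are
   neither in A nor adjacent to A. *)
Lemma pr_two_big_clusters m L x y : (0 < m)%N ->
  pr P (small_cluster L x (fun C => at_least m C /\ ~ C y) `&` big_cluster m y) <=
  cluster_tail P m ^+ 2.
Proof.
move=> m0.
(* The possible values of C(x): a cluster with fewer than [L] sites fits in the box of radius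
   [L]. *)
pose s : seq {fset site d} := [seq A <- fpowerset [fset z in box L x]%fset |
  (x \in A) && (m <= #|` A|)%N].
(* [A] together with its outer boundary: the states of these sites decide whether C(x) = A. *)
pose D (A : {fset site d}) z := (z \in A) || has ((@neighbour d)^~ z) A.
pose E (A : {fset site d}) :=
  [set w : config d | x \in A /\ site_cluster w x = [set` A]].
pose G (A : {fset site d}) :=
  [set w : config d | at_least m (site_cluster (restrict (fun z => ~~ D A z) w) y)].
pose K A := [seq z <- flatten [seq box 1 u | u <- enum_fset A] | D A z].
have KD A z : (z \in K A) = D A z.
  rewrite mem_filter andb_idr// => /orP[zA|/hasP[u uA uz]]; apply/flatten_mapP.
    by exists z => //; rewrite mem_box; exact: within_le (within_refl z).
  by exists u => //; rewrite mem_box; exact: neighbour_within.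
have dE A : depends (K A) (E A).
  move=> w w' ww' [xA CwA]; split=> //.
  have DAx : D A x by rewrite /D xA.
  have conf v u z : site_cluster v x = [set` A] ->
      site_cluster v x u -> neighbour u z -> D A z.
    by move=> -> uA uz; apply/orP; right; apply/hasP; exists u.
  have wDE : site_cluster w x = site_cluster (restrict (D A) w) x.
    apply: cluster_confined => // u z /cluster_restrict; exact: conf.
  have rE : restrict (D A) w' = restrict (D A) w.
    apply/funext => z; rewrite /restrict; case Dz : (D A z) => //=.
    by rewrite ww'// KD.
  rewrite (cluster_confined (D := D A))// rE -wDE// => u z; exact: conf.
have dG A : depends [seq z <- box m y | ~~ D A z] (G A).
  move=> w w' ww'; apply: at_least_local => z yz; rewrite /restrict.
  by case Dz : (D A z) => //=; apply: ww'; rewrite mem_filter Dz mem_box.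
have mE A : measurable (E A) by exact: (depends_measurable (dE A)).
have mG A : measurable (G A) by exact: (depends_measurable (dG A)).
have prEG A : pr P (E A `&` G A) = pr P (E A) * pr P (G A).
  apply: (prI perc (dE A) (dG A)) => z; rewrite KD mem_filter => ->//.
have prG A : pr P (G A) <= cluster_tail P m.
  rewrite -(pr_big_cluster m y); apply: pr_le => //.
    exact: measurable_big_cluster.
  by move=> w; apply: at_least_sub; exact: cluster_restrict.
apply: (le_trans (pr_bigU_le P (s := s) (F := fun A => E A `&` G A) _ _ _)).
- apply: measurableI; first exact: measurable_small_cluster.
  exact: measurable_big_cluster.
- by move=> A; exact: measurableI.
- move=> w [[nL [mC nCy]] mCy].
  have [A AE AL] := at_leastN_fset nL.
  have [Cx|nwx] := boolP (w x); last first.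
    have [[|z r] [_ rm rC]] := mC; first by rewrite -rm in m0.
    by have := rC z (mem_head _ _); rewrite cluster_vacant.
  have xA : x \in A by have := cluster_refl Cx; rewrite AE.
  exists A.
    rewrite mem_filter xA/=; apply/andP; split.
      by apply/at_least_fset; rewrite -AE.
    rewrite fpowersetE; apply/fsubsetP => z zA; rewrite !inE mem_box.
    apply: (within_le _ (cluster_within nL _)); first by lia.
    by rewrite AE.
  split; first by split.
  (* An occupied site adjacent to C(x) belongs to C(x), so the cluster of [y], being disjoint from
     C(x), avoids [D A]. *)
  have : site_cluster w y `<=` site_cluster (restrict (fun z => ~~ D A z) w) y.
    have notD z : site_cluster w y z -> ~~ D A z.
      move=> yz; apply/negP => Dz; apply: nCy.
      suff xz : site_cluster w x z by apply: cluster_trans xz _; exact: cluster_sym.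
      case/orP: Dz => [zA|/hasP[u uA uz]]; first by rewrite AE.
      apply: (cluster_step _ uz); first by rewrite AE.
      exact: cluster_occupied yz.
    move=> z yz; have wy := cluster_root yz; have nDy := notD _ (cluster_refl wy).
    move: z yz; apply: cluster_ind; first by apply: cluster_refl; rewrite /restrict nDy.
    move=> u z yu ru uz wz; apply: (cluster_step ru uz).
    by rewrite /restrict wz notD//; exact: cluster_step yu uz wz.
  by move=> /at_least_sub; exact.
under eq_bigr do rewrite prEG.
apply: (@le_trans _ _ (\sum_(A <- s) pr P (E A) * cluster_tail P m)).
  by apply: ler_sum => A _; apply: ler_wpM2l => //; exact: pr_ge0.
rewrite -mulr_suml expr2 ler_wpM2r ?cluster_tail_ge0//.
(* The events [E A] are disjoint, and for [A] in [s] they lie in [big_cluster m x], so their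
   probabilities add up to at most [cluster_tail P m]. *)
have -> : \sum_(A <- s) pr P (E A) = \sum_(A <- s) pr P (big_cluster m x `&` E A).
  rewrite big_seq [RHS]big_seq; apply: eq_bigr => A.
  rewrite mem_filter => /andP[/andP[_ mA] _]; congr pr; apply/esym/setIidr.
  by move=> w [xA /= CE]; rewrite /big_cluster /= CE; exact/at_least_fset.
apply: le_trans (pr_count_le P (c := 1) _ _ _) _ => //; first exact: measurable_big_cluster.
  move=> w _; rewrite lern1; apply: uniq_count_le1.
    by rewrite filter_uniq// fset_uniq.
  move=> A B /asboolP[_ CA] /asboolP[_ CB].
  by rewrite -(set_fsetK A) -(set_fsetK B) -CA -CB.
by rewrite mul1r pr_big_cluster.
Qed.

End Percolation.

Arguments big_cluster_depends {d} m x.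
Arguments small_cluster_depends {d} L x Q.
Arguments cluster_start_translate {d} m L a x w.

(** * Mass transport and the probability that no cluster starts in a box *)

Section PoissonApproximation.
Context {R : realType} {d : nat}.
Variables (P : probability (config d) R) (p : R).
Hypothesis perc : site_percolation p P.
Implicit Types (x y z : site d) (w : config d).

Let T := cluster_tail P.
Let start_prob m L := pr P (cluster_start m L 0).

Let pr_medium_cluster m L : (m <= L)%N ->
  pr P (small_cluster L 0 (at_least m)) = T m - T L.
Proof.
move=> mL; rewrite /T !cluster_tailE.
rewrite [in RHS](prID P (B := big_cluster L 0)); try exact: measurable_big_cluster.
rewrite (_ : big_cluster m 0 `&` big_cluster L 0 = big_cluster L 0).
  rewrite addrAC subrr add0r; congr pr; apply/seteqP.
  by split=> w [? ?]; split.
apply/seteqP; split=> w; first by case.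
by move=> wL; split=> //; exact: at_least_leq wL.
Qed.

(* Mass transport: summing over the position of the left endpoint of C(0) and
   translating it to the origin counts a cluster once per site. *)
Lemma mass_transport m L : (0 < m)%N ->
  pr P (small_cluster L 0 (at_least m)) =
  \sum_(z <- box L 0) pr P (cluster_start m L 0 `&`
                            small_cluster L 0 (fun C => C z)).
Proof.
move=> m0; set H := small_cluster _ _ _.
pose F z := small_cluster L 0 (fun C : set (site d) => C z /\ left_endpoint C z).
have -> : pr P H = \sum_(z <- box L 0) pr P (H `&` F z).
  have cnt w : H w -> count (fun z => `[< F z w >]) (box L 0) = 1%N.
    move=> [nL mC]; apply/eqP; rewrite eqn_leq; apply/andP; split.
      apply: uniq_count_le1; first exact: box_uniq.
      move=> x y /asboolP[_ [Cx lx]] /asboolP[_ [Cy ly]].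
      by apply: (left_endpoint_unique Cx Cy);
        [rewrite (cluster_eq Cx)|rewrite (cluster_eq Cy)].
    rewrite -has_count; apply/hasP.
    have w0 : w 0.
      apply: contrapT => /negP nw0; case: mC => -[|z r] [_ rm rC].
        by rewrite -rm in m0.
      by have := rC z (mem_head _ _); rewrite cluster_vacant.
    have [y Cy ly] := cluster_left_endpoint nL w0.
    exists y; last by apply/asboolP; split=> //; split=> //; rewrite -(cluster_eq Cy).
    rewrite mem_box; apply: (within_le _ (cluster_within nL Cy)); lia.
  apply/eqP; rewrite eq_le; apply/andP; split.
    rewrite -[leLHS]mul1r; apply: pr_count_ge.
    - exact: measurable_small_cluster.
    - by move=> z; exact: measurable_small_cluster.
    - by move=> w /cnt ->.
  rewrite -[leRHS]mul1r; apply: pr_count_le.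
  - exact: measurable_small_cluster.
  - by move=> z; exact: measurable_small_cluster.
  - by move=> w /cnt ->.
(* When the left endpoint sits at [z], translating it to the origin sends the origin to [- z]; hence
   the reindexing by reflection. *)
have boxN : perm_eq (box L (0 : site d)) [seq - z | z <- box L 0].
  apply: uniq_perm; first exact: box_uniq.
    by rewrite (map_inj_uniq oppr_inj); exact: box_uniq.
  move=> z; rewrite -[z in RHS]opprK (mem_map oppr_inj) !mem_box.
  by rewrite -(withinD _ z 0 (- z)) addNr add0r within_sym.
rewrite [RHS](perm_big _ boxN) [RHS]big_map; apply: eq_bigr => z _.
pose E := cluster_start m L 0 `&` small_cluster L 0 (fun C => C (- z)).
have dE : depends (box L 0 ++ box L 0) E.
  by apply: dependsI; exact: small_cluster_depends.
rewrite -/E -(pr_translate perc z dE); congr pr; apply/seteqP; split=> w.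
  move=> [[nL mC] [_ [Cz lz]]].
  have Ez : site_cluster w z = site_cluster w 0 by exact: cluster_eq.
  split; first by apply/(cluster_start_translate m L z 0 w);
    rewrite add0r; split; rewrite /= Ez.
  split; first by move=> /at_least_translate; rewrite add0r Ez.
  by apply/cluster_translate; rewrite add0r addNr; exact: cluster_sym.
move=> [/(cluster_start_translate m L z 0 w) + [_ /cluster_translate]].
rewrite add0r addNr => -[nL [mC lz]] Cz0.
have Ez : site_cluster w 0 = site_cluster w z by exact: cluster_eq.
by split; split; rewrite /= Ez//; split=> //; exact: lz.1.
Qed.

(** On [cluster_start m L 0] the sum of [mass_transport] counts the sites of C(0), at least [m] of
    them. *)
Lemma start_prob_upper m L : (0 < m)%N -> (m <= L)%N ->
  m%:R * start_prob m L <= T m.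
Proof.
move=> m0 mL; apply: (@le_trans _ _ (T m - T L)); last first.
  by rewrite gerBl cluster_tail_ge0.
rewrite -pr_medium_cluster// mass_transport//; apply: pr_count_ge.
- exact: measurable_small_cluster.
- by move=> z; exact: measurable_small_cluster.
- move=> w [nL [mC _]]; rewrite ler_nat -size_filter.
  case: mC => s [us <- sC]; apply: uniq_leq_size => // z /sC Cz.
  rewrite mem_filter mem_box; apply/andP; split; first exact/asboolP.
  by apply: (within_le _ (cluster_within nL Cz)); lia.
Qed.

(** Truncating at [m + j] caps the count of [mass_transport] at [m + j], and a start truncated there
    is also a start truncated at [L]. *)
Lemma start_prob_lower m L j : (0 < m)%N -> (m + j <= L)%N ->
  T m - T (m + j) <= (m + j)%:R * start_prob m L.
Proof.
move=> m0 mjL; rewrite -pr_medium_cluster ?leq_addr// mass_transport//.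
apply: (@le_trans _ _ ((m + j)%:R * start_prob m (m + j))).
  apply: pr_count_le.
  - exact: measurable_small_cluster.
  - by move=> z; exact: measurable_small_cluster.
  - move=> w [nL _]; rewrite ler_nat -size_filter leqNgt; apply/negP => /ltnW h.
    apply: nL; apply: (at_least_leq h).
    exists [seq z <- box (m + j) 0 |
       `[< small_cluster (m + j) 0 (fun C : set (site d) => C z) w >]].
    split=> //; first by rewrite filter_uniq// box_uniq.
    by move=> z; rewrite mem_filter => /andP[/asboolP[]].
rewrite ler_wpM2l//; apply: pr_le; try exact: measurable_small_cluster.
move=> w [nL Q]; split=> //; apply: contra_not nL; exact: at_least_leq.
Qed.

Lemma start_prob_le m L : start_prob m L <= T m.
Proof.
rewrite /T cluster_tailE; apply: pr_le; first exact: measurable_small_cluster.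
  exact: measurable_big_cluster.
by move=> w [_ []].
Qed.

Lemma pr_two_starts m L x y : (0 < m)%N -> x != y ->
  pr P (cluster_start m L x `&` cluster_start m L y) <= T m ^+ 2.
Proof.
move=> m0 xy; apply: le_trans (pr_two_big_clusters perc L x y m0).
apply: pr_le.
- by apply: measurableI; exact: measurable_small_cluster.
- by apply: measurableI; [exact: measurable_small_cluster|exact: measurable_big_cluster].
move=> w [[nL [mx lx]] [_ [my ly]]]; split=> //; split=> //; split=> // Cxy.
by case/eqP: xy; exact: (left_endpoint_unique lx.1 Cxy lx ly).
Qed.

Lemma pr_no_start m L n : (0 < m)%N ->
  `|pr P [set w | forall x, x \in box n 0 -> ~ cluster_start m L x w] -
    (1 - start_prob m L) ^+ ((2 * n).+1 ^ d)|
  <= ((2 * n).+1 ^ d)%:R * (((4 * L).+1 ^ d)%:R * (2%:R * T m ^+ 2)).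
Proof.
move=> m0; rewrite -(size_box n (0 : site d)).
have q0 : 0 <= start_prob m L by exact: pr_ge0.
(* Boxes of radius [L] around sites more than [2 * L] apart are disjoint, and a ball of radius
   [2 * L] has [(4 * L).+1 ^ d] sites. The bound [b] is twice [T m ^+ 2]: once for the pair, once
   for the squared probability of a start. *)
apply: (pr_none_approx (X := cluster_start m L) (near := within (2 * L)%N)).
- by rewrite mulr_ge0// sqr_ge0.
- exact: box_uniq.
- by move=> x; exact: measurable_small_cluster.
- by move=> x _; exact: (pr_cluster_start perc).
- move=> x y _ _ xy; rewrite mulr_natl mulr2n lerD//.
    by apply: pr_two_starts; rewrite // eq_sym.
  by rewrite lerXn2r ?nnegrE ?start_prob_le// cluster_tail_ge0.
- move=> x _; rewrite -size_filter (_ : (4 * L = 2 * (2 * L))%N); last by lia.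
  rewrite -(size_box (2 * L) x); apply: uniq_leq_size.
    by rewrite filter_uniq// box_uniq.
  by move=> y; rewrite mem_filter [y \in box (2 * L) x]mem_box => /andP[].
move=> x r _ _ xr; rewrite /start_prob -(pr_cluster_start perc m L x).
have dN : depends (flatten [seq box L y | y <- r])
    [set w | forall y, y \in r -> ~ cluster_start m L y w].
  move=> w w' ww' N y yr; apply: contra_not (N y yr).
  apply: small_cluster_depends => z yz; apply/esym/ww'.
  by apply/flatten_mapP; exists y.
apply: (prI perc dN (small_cluster_depends L x _)) => z.
move=> /flatten_mapP[y yr]; rewrite !mem_box => yz; apply/negP => xz.
have := xr y yr; rewrite (_ : (2 * L = L + L)%N); last by lia.
by rewrite (within_trans xz)// within_sym.
Qed.

End PoissonApproximation.

(** * Explicit error bound for the law of the maximal cluster size *)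

Section FiniteBound.
Context {R : realType} {d : nat}.
Variables (P : probability (config d) R) (p : R).
Hypothesis perc : site_percolation p P.
Implicit Types (x y z : site d) (w : config d).

Let T := cluster_tail P.

(** Clusters in a box are finite, so each has a left endpoint and is seen by the maximum over left
    endpoints. *)
Lemma max_cluster_leP n t w : (max_cluster n w <= t)%N <->
  forall x, ~ at_least t.+1 (site_cluster (restrict_box n w) x).
Proof.
set v := restrict_box n w.
have inB y z : site_cluster v y z -> z \in box n 0.
  by move=> /cluster_occupied; rewrite /v restrict_boxE mem_box => /andP[].
have fin y : finite_set (site_cluster v y).
  by apply: (@sub_finite_set _ _ [set` box n 0]) => // z /inB.
have finle y : finite_set (cluster_le v y).
  by apply: sub_finite_set (fin y) => z [].
pose f y := #|` fset_set (cluster_le v y)|.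
have f0 y : [set: site d] y -> y \notin box n 0 -> f y = 0%N.
  move=> _ yn; rewrite /f (_ : cluster_le v y = set0) ?fset_set0// -subset0.
  by move=> z [[/inB yy _] _]; rewrite yy in yn.
rewrite /max_cluster -/v (fsbigE _ _ (box_uniq n 0) (@subsetT _ _) f0).
have atf (A : set (site d)) : finite_set A -> at_least t.+1 A <-> (t < #|` fset_set A|)%N.
  by move=> finA; rewrite -[X in at_least _ X](fset_setK finA); exact: at_least_fset.
split=> [/bigmax_leqP_seq ft x xt|ft].
  have vx : v x.
    apply: contrapT => /negP nx; case: xt => -[|z r] [_ // _ rC].
    by have := rC z (mem_head _ _); rewrite cluster_vacant.
  have nC : ~ at_least (#|` fset_set (site_cluster v x)|).+1 (site_cluster v x).
    by rewrite -[X in at_least _ X](fset_setK (fin x)) => /at_least_fset; rewrite ltnn.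
  have [z xz lz] := cluster_left_endpoint nC vx.
  have zle : cluster_le v z = site_cluster v x.
    by rewrite -(cluster_eq xz); apply/seteqP; split=> u; [case|split].
  have := ft z (inB _ _ xz); rewrite /f inE => /(_ I).
  by apply/negP; rewrite -ltnNge zle; apply/atf.
apply/bigmax_leqP_seq => y _ _; rewrite leqNgt; apply/negP => /(iffRL (atf _ (finle y))).
by move=> yt; apply: (ft y); apply: at_least_sub yt => z [].
Qed.

Lemma measurable_max_cluster n t :
  measurable [set w : config d | (max_cluster n w <= t)%N].
Proof.
apply: (@depends_measurable _ (box n 0)) => w w' ww' /=.
rewrite /max_cluster; suff -> : restrict_box n w' = restrict_box n w by [].
apply/funext => y; rewrite /restrict_box in_boxE; case yn : (within n 0 y) => //=.
by rewrite ww'// mem_box.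
Qed.

(* The two events differ only through clusters of size at least L or through
   big clusters close to the boundary of the box. *)
Lemma max_cluster_vs_no_start n t L : (t < L <= n)%N ->
  `|pr P [set w : config d | (max_cluster n w <= t)%N] -
    pr P [set w | forall x, x \in box n 0 -> ~ cluster_start t.+1 L x w]|
  <= ((2 * n).+1 ^ d)%:R * T L +
     ((2 * n).+1 ^ d - (2 * (n - L)).+1 ^ d)%:R * T t.+1.
Proof.
move=> /andP[tL Ln]; set M := [set w | (_ <= t)%N]; set N := [set w | forall x, _].
pose bd : seq (site d) := [seq y <- box n 0 | ~~ within (n - L) 0 y].
(* The exceptional events, coded by a size threshold and a site: size [L] anywhere in the box, size
   [t.+1] in the boundary layer. *)
pose s := [seq (L, y) | y <- box n (0 : site d)] ++ [seq (t.+1, y) | y <- bd].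
pose F (k : nat * site d) := big_cluster k.1 k.2.
have mM : measurable M by exact: measurable_max_cluster.
have mN : measurable N.
  apply: (@depends_measurable _ (flatten [seq box L y | y <- box n 0])).
  move=> w w' ww' Nw y yn; apply: contra_not (Nw y yn).
  apply: small_cluster_depends => z yz; apply/esym/ww'.
  by apply/flatten_mapP; exists y.
have mF k : measurable (F k) by exact: measurable_big_cluster.
have -> : ((2 * n).+1 ^ d)%:R * T L +
     ((2 * n).+1 ^ d - (2 * (n - L)).+1 ^ d)%:R * T t.+1 = \sum_(k <- s) pr P (F k).
  have sumE k (r : seq (site d)) : \sum_(i <- [seq (k, y) | y <- r]) pr P (F i) =
      (size r)%:R * T k.
    rewrite big_map (eq_bigr (fun=> T k)); last first.
      by move=> y _; exact: (pr_big_cluster perc).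
    by rewrite big_const_seq count_predT iter_addr_0 mulr_natl.
  rewrite big_cat /= !sumE size_box; congr (_ + _%:R * _).
  rewrite /bd size_filter.
  have := count_predC (within (n - L) (0 : site d)) (box n 0).
  rewrite size_box => <-; rewrite -(size_box (n - L) (0 : site d)) -size_filter.
  rewrite (perm_size (s2 := box (n - L) 0)) ?addKn//.
  apply: uniq_perm; rewrite ?filter_uniq ?box_uniq// => y.
  rewrite mem_filter !mem_box andb_idr// => /within_le; apply.
  exact: leq_subr.
have NM w : N w -> ~ M w -> exists2 k, k \in s & F k w.
  move=> Nw nMw.
  have [x mx] : exists x, at_least t.+1 (site_cluster (restrict_box n w) x).
    by apply: contrapT => nx; apply: nMw; apply/max_cluster_leP => x mx; apply: nx; exists x.
  have xB : in_box n x && w x.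
    apply: contrapT => /negP nx; case: mx => -[|z r] [_ // _ rC].
    by have := rC z (mem_head _ _); rewrite cluster_vacant.
  move/andP: xB; rewrite in_boxE => -[xn wx].
  have {}mx : at_least t.+1 (site_cluster w x).
    by apply: at_least_sub mx; rewrite restrict_boxE; exact: cluster_restrict.
  have [Lx|nLx] := pselect (at_least L (site_cluster w x)).
    by exists (L, x) => //; rewrite mem_cat map_f// mem_box.
  exists (t.+1, x) => //; rewrite mem_cat orbC map_f// mem_filter mem_box xn andbT.
  (* This is the left endpoint in the full configuration. Inside the box it would contradict [N]; so
     it lies outside, and [x] is within [L] of it. *)
  have [z xz lz] := cluster_left_endpoint nLx wx.
  have /negP zn : z \notin box n 0.
    apply/negP => /Nw; apply; split; rewrite /= (cluster_eq xz)//; split=> //.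
    by rewrite -(cluster_eq xz).
  apply/negP => x0; apply: zn; rewrite mem_box.
  by apply: (within_le _ (within_trans x0 (cluster_within nLx xz))); lia.
have MN w : M w -> ~ N w -> exists2 k, k \in s & F k w.
  move=> Mw nNw.
  have [x [xn [nLx [mx lx]]]] : exists x, x \in box n 0 /\ cluster_start t.+1 L x w.
    by apply: contrapT => nx; apply: nNw => x xn mx; apply: nx; exists x.
  exists (t.+1, x) => //; rewrite mem_cat orbC map_f// mem_filter xn andbT.
  (* At distance [L] from the boundary, restricting to the box does not cut the cluster. *)
  apply/negP => x0; move/max_cluster_leP: Mw => /(_ x); apply.
  rewrite restrict_boxE -(small_cluster_restrict (L := L))//.
    move=> y xy; apply: (within_le _ (within_trans x0 xy)); lia.
  by apply: contra_not nLx; apply: at_least_sub; exact: cluster_restrict.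
have half (A B : set (config d)) : measurable A -> measurable B ->
    (forall w, A w -> ~ B w -> exists2 k, k \in s & F k w) ->
    pr P A - pr P B <= \sum_(k <- s) pr P (F k).
  move=> mA mB AB; rewrite (prID P mA mB) lerBlDr addrC.
  apply: lerD; last by apply: pr_le => //; exact: measurableI.
  apply: pr_bigU_le => //; last by move=> w [/AB].
  by apply: measurableI => //; exact: measurableC.
by rewrite ler_norml lerNl opprB !half.
Qed.

(** A discrete mean value inequality, used to count the sites of the boundary layer. *)
Lemma pow_sub_le (N M k : nat) : (M <= N)%N ->
  (N ^ k.+1 - M ^ k.+1 <= k.+1 * (N - M) * N ^ k)%N.
Proof.
move=> MN; elim: k => [|k IHk]; first by rewrite !expn1 expn0; lia.
have h : (M ^ k.+1 <= N ^ k.+1)%N by rewrite leq_exp2r.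
rewrite (expnS N) (expnS M).
have -> : (N * N ^ k.+1 - M * M ^ k.+1 = N * (N ^ k.+1 - M ^ k.+1) + (N - M) * M ^ k.+1)%N.
  rewrite mulnBr mulnBl addnBA ?leq_mul//; nia.
have -> : (k.+2 * (N - M) * N ^ k.+1 = N * (k.+1 * (N - M) * N ^ k) + (N - M) * N ^ k.+1)%N.
  by rewrite expnS; ring.
by apply: leq_add; rewrite leq_mul2l ?IHk ?h orbT.
Qed.

(** Replacing the [k] factors one at a time costs at most [q ^+ 2] each, as all other factors lie in
    [0, 1]. *)
Lemma expR_pow_approx (q : R) (k : nat) : 0 <= q <= 1 ->
  `|(1 - q) ^+ k - expR (- (k%:R * q))| <= k%:R * q ^+ 2.
Proof.
move=> /andP[q0 q1]; elim: k => [|k IHk].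
  by rewrite expr0 mul0r oppr0 expR0 subrr normr0 mul0r.
set e := expR (- (k%:R * q)) in IHk *.
have -> : expR (- (k.+1%:R * q)) = expR (- q) * e.
  by rewrite -expRD; congr expR; rewrite -natr1; ring.
have e1 : 0 <= e <= 1.
  by rewrite expR_ge0 -expR0 ler_expR oppr_le0 mulr_ge0.
have h1 : 1 - q <= expR (- q) by exact: expR_ge1Dx.
(* The left side is at most 1 / (1 + q), and (1 - q + q^2) (1 + q) = 1 + q^3 >= 1. *)
have h2 : expR (- q) <= 1 - q + q ^+ 2.
  have h3 : 1 + q <= expR q by exact: expR_ge1Dx.
  rewrite expRN; apply: (@le_trans _ _ (1 + q)^-1).
    by rewrite lef_pV2 ?posrE ?expR_gt0//; lra.
  rewrite -div1r ler_pdivrMr; last by lra.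
  nra.
rewrite exprS -natr1 [leRHS]mulrDl mul1r.
have -> : (1 - q) * (1 - q) ^+ k - expR (- q) * e =
  (1 - q) * ((1 - q) ^+ k - e) + - ((expR (- q) - (1 - q)) * e) by ring.
apply: (le_trans (ler_normD _ _)); apply: lerD.
  rewrite normrM ger0_norm ?subr_ge0//; apply: le_trans IHk.
  by rewrite ler_piMl// gerBl.
case/andP: e1 => e0 e1.
rewrite normrN ger0_norm ?mulr_ge0// ?subr_ge0//.
apply: (@le_trans _ _ (expR (- q) - (1 - q))); first by rewrite ler_piMr// subr_ge0.
lra.
Qed.

Lemma max_cluster_poisson n t L (N := (2 * n).+1%N) :
  (0 < d)%N -> (t < L <= n)%N ->
  `|pr P [set w : config d | (max_cluster n w <= t)%N] -
    expR (- ((N ^ d)%:R * pr P (cluster_start t.+1 L 0)))|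
  <= (N ^ d)%:R * T L + (2 * L * d * N ^ d.-1)%:R * T t.+1 +
     (N ^ d * (2 * (4 * L).+1 ^ d).+1)%:R * T t.+1 ^+ 2.
Proof.
move=> d0 tLn; have := max_cluster_vs_no_start tLn.
have := pr_no_start perc L n (ltn0Sn t).
have q0 : 0 <= pr P (cluster_start t.+1 L 0) by exact: pr_ge0.
have qT : pr P (cluster_start t.+1 L 0) <= T t.+1 by exact: start_prob_le.
have q1 := le_trans qT (cluster_tail_le1 P t.+1).
have := expR_pow_approx (N ^ d) (introT andP (conj q0 q1)).
set q := pr P (cluster_start _ _ _) in q0 qT q1 *.
set e := expR _; set A := pr P _; set B := pr P _.
have qT2 : q ^+ 2 <= T t.+1 ^+ 2 by rewrite lerXn2r ?nnegrE// (le_trans q0).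
have bd : ((2 * n).+1 ^ d - (2 * (n - L)).+1 ^ d)%:R * T t.+1 <=
    (2 * L * d * N ^ d.-1)%:R * T t.+1.
  rewrite ler_wpM2r ?cluster_tail_ge0// ler_nat.
  rewrite -(prednK d0); apply: leq_trans (pow_sub_le _ _) _; first by lia.
  by rewrite leq_mul2r; apply/orP; right; nia.
move=> h1 h2 h3.
have h4 : (N ^ d)%:R * q ^+ 2 <= (N ^ d)%:R * T t.+1 ^+ 2 by exact: ler_wpM2l.
have -> : (N ^ d * (2 * (4 * L).+1 ^ d).+1)%:R * T t.+1 ^+ 2 =
   (N ^ d)%:R * (((4 * L).+1 ^ d)%:R * (2%:R * T t.+1 ^+ 2)) +
   (N ^ d)%:R * T t.+1 ^+ 2.
  by rewrite natrM -natr1 [in LHS](natrM _ 2); ring.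
apply: le_trans (ler_distD A _ _) _.
have := ler_distD ((1 - q) ^+ (N ^ d)) A e.
rewrite -/N -/T in h2 h3 bd.
lra.
Qed.

End FiniteBound.

(** * Limits of shifted ratios and of polynomials against exponentials *)

Section ShiftedRatios.
Context {R : realType}.

(** A product of [x] consecutive ratios. Nonvanishing is asked from index 1 on, so that the lemma
    applies to [k%:R^-1], whose value at 0 is 0. *)
Lemma cvg_ratio_shift (f : nat -> R) (l : R) :
  (forall k, f k.+1 != 0) -> (fun k => f k.+1 / f k) @ \oo --> l ->
  forall x, (fun k => f (k + x)%N / f k) @ \oo --> l ^+ x.
Proof.
move=> f0 fl; elim=> [|x IHx].
  rewrite expr0; apply: cvg_near_cst; near=> k.
  have k0 : (0 < k)%N by near: k; exact: nbhs_infty_gt.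
  by rewrite addn0 divff// -(prednK k0).
have flx : (fun k => f (k + x).+1 / f (k + x)%N) @ \oo --> l.
  by have := fl; rewrite -(cvg_shiftn x).
rewrite exprS; apply: cvg_trans (cvgM flx IHx); apply: near_eq_cvg.
near=> k; have k0 : (0 < k)%N by near: k; exact: nbhs_infty_gt.
rewrite /= addnS. rewrite mulf_div [_ * f (_ + _)%N]mulrC -mulf_div.
by rewrite divff ?mul1r// -(prednK k0) addSn.
Unshelve. all: end_near. Qed.

Lemma cvg_natr_ratio x : (fun k => k%:R / (k + x)%:R : R) @ \oo --> (1 : R).
Proof.
have h : (fun k => k.+1%:R^-1 / k%:R^-1 : R) @ \oo --> (1 : R).
  rewrite (_ : (fun k => _) = (fun k => 1 - harmonic k)).
    by rewrite -[X in _ --> X]subr0; apply: cvgB; [exact: cvg_cst|exact: cvg_harmonic].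
  apply/funext => k; rewrite /harmonic /= invrK -natr1; field.
  by rewrite natr1 pnatr_eq0.
have nz k : (k.+1%:R : R)^-1 != 0 by rewrite invr_neq0// pnatr_eq0.
have := @cvg_ratio_shift (fun k => k%:R^-1) 1 nz h x.
rewrite expr1n => h1; apply: cvg_trans h1; apply: near_eq_cvg; near=> k.
by rewrite invrK mulrC.
Unshelve. all: end_near. Qed.

Lemma cvg_poly_exp (s : R) (k : nat) : 0 < s ->
  (fun n => n%:R ^+ k * expR (- (n%:R * s))) @ \oo --> (0 : R).
Proof.
(* From the Taylor term of order [k.+2] of the exponential: the two extra powers leave c / n^2,
   which is below c / (n + 1) for n >= 2. *)
move=> s0; pose c : R := k.+2`!%:R / s ^+ k.+2.
have c0 : 0 <= c by rewrite divr_ge0// exprn_ge0// ltW.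
apply: (@squeeze_cvgr _ _ _ _ (cst 0) (fun n => c * harmonic n)); last 2 first.
- exact: cvg_cst.
- by rewrite -(mulr0 c); apply: cvgM; [exact: cvg_cst|exact: cvg_harmonic].
near=> n; rewrite /= mulr_ge0 ?exprn_ge0 ?expR_ge0//=.
have n0 : (1 < n)%N by near: n; exact: nbhs_infty_gt.
have nR : 0 < n%:R :> R by rewrite ltr0n ltnW.
have := @expR_ge1Dxn R (n%:R * s) k.+1 (mulr_ge0 (ltW nR) (ltW s0)).
move=> h; have {}h : (n%:R * s) ^+ k.+2 / k.+2`!%:R <= expR (n%:R * s) by lra.
rewrite expRN -(@ler_pM2r _ (expR (n%:R * s))) ?expR_gt0// divfK ?gt_eqF ?expR_gt0//.
apply: (@le_trans _ _ (c * harmonic n * ((n%:R * s) ^+ k.+2 / k.+2`!%:R))); last first.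
  by rewrite ler_wpM2l// mulr_ge0// harmonic_ge0.
have -> : c * harmonic n * ((n%:R * s) ^+ k.+2 / k.+2`!%:R) =
   n%:R ^+ k * (n%:R ^+ 2 / n.+1%:R).
  rewrite /c /harmonic /= exprMn !exprS expr0; field.
  by rewrite nat1r !pnatr_eq0 (gtn_eqF (fact_gt0 _)) expf_neq0 (gt_eqF s0).
rewrite ler_peMr ?exprn_ge0// ler_pdivlMr ?ltr0n// mul1r -natrX ler_nat.
by rewrite expnS expn1; nia.
Unshelve. all: end_near. Qed.

Lemma cvgny_near_ge (v : nat -> nat) : v @ \oo --> \oo ->
  forall A, \forall n \near \oo, (A <= v n)%N.
Proof. by move/cvgnyPge. Qed.

Lemma cvg0_of_pow (y : nat -> R) (k : nat) : (forall n, 0 <= y n) ->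
  (fun n => y n ^+ k.+1) @ \oo --> (0 : R) -> y @ \oo --> (0 : R).
Proof.
move=> y0 /cvgr0Pnorm_le yk; apply/cvgr0Pnorm_le => e e0.
have := yk (e ^+ k.+1) (exprn_gt0 _ e0); apply: filterS => n.
by rewrite normrX ler_pXn2r// nnegrE// ltW.
Qed.

End ShiftedRatios.

(** * Consequences of the tail ratio and the choice of the scale *)

Section TailAsymptotics.
Context {R : realType}.
Variables (T : nat -> R) (zeta : R).
Hypothesis zeta_gt0 : 0 < zeta.
Hypothesis T_ge0 : forall k, 0 <= T k.
Hypothesis T_le1 : forall k, T k <= 1.
Hypothesis T_le : forall m n, (m <= n)%N -> T n <= T m.
Hypothesis T_ratio : (fun k => T k.+1 / T k) @ \oo --> expR (- zeta).

Definition weighted_tail k := T k / k%:R.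

(** A zero of [T] would persist by monotonicity, and the ratios, 0 / 0 = 0 by convention, could not
    tend to a positive limit. *)
Lemma tail_gt0 k : 0 < T k.
Proof.
have := cvgr_gt _ T_ratio 0 (expR_gt0 _).
move=> [K _ hK]; rewrite lt_neqAle T_ge0 andbT; apply/eqP => Tk.
have : 0 < T (k + K).+1 / T (k + K)%N by apply: hK; rewrite /= leq_addl.
have TkK : T (k + K)%N = 0.
  by apply/le_anti; rewrite T_ge0 andbT [leRHS]Tk T_le// leq_addr.
by rewrite TkK invr0 mulr0 ltxx.
Qed.

Lemma tail_neq0 k : T k != 0.
Proof. by rewrite gt_eqF// tail_gt0. Qed.

Lemma weighted_tail_gt0 k : 0 < weighted_tail k.+1.
Proof. by rewrite divr_gt0// tail_gt0. Qed.

Lemma weighted_tail_le m n : (0 < m)%N -> (m <= n)%N ->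
  weighted_tail n <= weighted_tail m.
Proof.
move=> m0 mn; apply: ler_pM => //; first exact: T_le.
by rewrite lef_pV2 ?posrE ?ltr0n ?(leq_trans m0)// ler_nat.
Qed.

Lemma tail_shift x : (fun k => T (k + x)%N / T k) @ \oo --> expR (- (x%:R * zeta)).
Proof.
rewrite -mulrN expRM_natl; apply: cvg_ratio_shift => // k; exact: tail_neq0.
Qed.

Lemma weighted_tail_shift x :
  (fun k => weighted_tail (k + x) / weighted_tail k) @ \oo --> expR (- (x%:R * zeta)).
Proof.
suff -> : (fun k => weighted_tail (k + x) / weighted_tail k) =
  (fun k => T (k + x)%N / T k * (k%:R / (k + x)%:R)).
  rewrite -[expR _]mulr1; apply: cvgM; first exact: tail_shift.
  exact: cvg_natr_ratio.
apply/funext => -[|k]; first by rewrite /weighted_tail !(invr0, mulr0, mul0r).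
rewrite /weighted_tail; field.
by rewrite tail_neq0 nat1r -natrD !pnatr_eq0.
Qed.

Let s := zeta / 2.

(** [s < zeta], so the ratios are eventually below exp(- s). The bound is relative to [T k] because
    it is [V n * T (U n)] that the scale controls. *)
Lemma tail_decay_rel : exists K, forall k i, (K <= k)%N ->
  T (k + i) <= expR (- (i%:R * s)) * T k.
Proof.
have s0 : 0 < s by rewrite divr_gt0.
have lt_e : expR (- zeta) < expR (- s)
  by rewrite ltr_expR ltrN2 ltr_pdivrMr ?ltr0n// mulr_natr mulr2n ltrDl.
have [K _ hK] := cvgr_le _ T_ratio _ lt_e.
exists K => k i Kk; elim: i => [|i IHi].
  by rewrite addn0 mul0r oppr0 expR0 mul1r.
rewrite addnS; apply: (@le_trans _ _ (expR (- s) * T (k + i)%N)).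
  by rewrite -ler_pdivrMr ?tail_gt0//; apply: hK; rewrite /= (leq_trans Kk)// leq_addr.
rewrite -natr1 mulrDl mul1r opprD [expR (_ + _)]expRD [_ * expR (- s)]mulrC -mulrA.
by rewrite ler_wpM2l// expR_ge0.
Qed.

Lemma tail_decay : exists2 C, 0 < C & forall k, T k <= C * expR (- (k%:R * s)).
Proof.
have s0 : 0 < s by rewrite divr_gt0.
have [K hK] := tail_decay_rel.
exists (expR (K%:R * s)); first exact: expR_gt0.
move=> k; rewrite -expRD; have [Kk|kK] := leqP K k.
  have := hK K (k - K)%N (leqnn _); rewrite subnKC// => /le_trans; apply.
  apply: (@le_trans _ _ (expR (- ((k - K)%:R * s)))).
    by rewrite ler_piMr// expR_ge0.
  by rewrite natrB// ler_expR; lra.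
apply: le_trans (T_le1 k) _; rewrite -[leLHS]expR0 ler_expR -mulrBl.
rewrite mulr_ge0 ?(ltW s0)//.
by rewrite subr_ge0 ler_nat ltnW.
Qed.


(** For a start with [m = k.+1 + x] and [L = 2 * k.+1 + x], the condition [j <= k] ensures
    [m + j <= L]. *)
Lemma ratio_cvg_of_bounds (q : nat -> R) (x : nat) :
  (forall k, (k.+1 + x)%:R * q k.+1 <= T (k.+1 + x)) ->
  (forall k j, (j <= k)%N ->
     T (k.+1 + x) - T (k.+1 + x + j) <= (k.+1 + x + j)%:R * q k.+1) ->
  (fun k => q k / weighted_tail k) @ \oo --> expR (- (x%:R * zeta)).
Proof.
move=> q_le q_ge; apply/cvgrPdist_le => e e0.
set l := expR _.
have e2 : 0 < e / 2 by rewrite divr_gt0.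
(* With [j] fixed, the lower bound tends to [l - expR (- ((x + j)%:R * zeta))]; this choice keeps
   the loss below [e / 2]. *)
have [j hj] : exists j, expR (- (j%:R * zeta)) <= e / 2.
  have := @cvg_poly_exp R zeta 0 zeta_gt0; move/cvgr0Pnorm_le => /(_ _ e2)[j _ hj].
  exists j; have := hj j (leqnn j); rewrite expr0 mul1r.
  by rewrite ger0_norm ?expR_ge0.
have lo : (fun k => (T (k + x)%N / T k - T (k + (x + j))%N / T k) *
    (k%:R / (k + (x + j))%:R)) @ \oo --> (l - expR (- ((x + j)%:R * zeta))) * 1.
  apply: cvgM; last exact: cvg_natr_ratio.
  by apply: cvgB; exact: tail_shift.
have hi := @weighted_tail_shift x.
rewrite mulr1 in lo; set lj := l - _ in lo.
have lje : lj - e / 2 < lj by lra.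
have lle : l < l + e by lra.
have ljl : l - e / 2 <= lj.
  rewrite /lj lerD2l lerN2; apply: le_trans hj; rewrite ler_expR lerN2.
  by rewrite ler_wpM2r ?(ltW zeta_gt0)// ler_nat leq_addl.
near=> k.
have k0 : (0 < k)%N by near: k; exact: nbhs_infty_gt.
have jk : (j < k)%N by near: k; exact: nbhs_infty_gt.
have k0R : 0 < k%:R :> R by rewrite ltr0n.
have G0 : 0 < weighted_tail k by rewrite -(prednK k0) weighted_tail_gt0.
have lo_k : lj - e / 2 <= (T (k + x)%N / T k - T (k + (x + j))%N / T k) *
    (k%:R / (k + (x + j))%:R) by near: k; exact: (cvgr_ge _ lo _ lje).
have hi_k : weighted_tail (k + x) / weighted_tail k <= l + e.
  by near: k; exact: (cvgr_le _ hi _ lle).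
have q_hi : q k / weighted_tail k <= weighted_tail (k + x) / weighted_tail k.
  rewrite ler_pM2r ?invr_gt0// /weighted_tail ler_pdivlMr ?ltr0n ?ltn_addr//.
  by rewrite mulrC; have := q_le k.-1; rewrite prednK.
have q_lo : (T (k + x)%N / T k - T (k + (x + j))%N / T k) *
    (k%:R / (k + (x + j))%:R) <= q k / weighted_tail k.
  have -> : (T (k + x)%N / T k - T (k + (x + j))%N / T k) *
      (k%:R / (k + (x + j))%:R) =
      (T (k + x)%N - T (k + (x + j))%N) / (k + (x + j))%:R / weighted_tail k.
    by rewrite /weighted_tail invf_div -mulrBl !mulf_div [T k * _]mulrC.
  rewrite ler_pM2r ?invr_gt0// ler_pdivrMr ?ltr0n ?ltn_addr// mulrC addnA.
  by have := q_ge k.-1 j; rewrite prednK//; apply; rewrite -ltnS prednK.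
rewrite ler_norml; apply/andP; split; lra.
Unshelve. all: end_near. Qed.

Variable d : nat.
Hypothesis d_gt0 : (0 < d)%N.

Let N n : R := (2 * n).+1%:R.
Let V n : R := N n ^+ d.

Let N_gt0 n : 0 < N n. Proof. by rewrite ltr0n. Qed.
Let V_gt0 n : 0 < V n. Proof. exact: exprn_gt0. Qed.

Let V_ge n : n%:R <= V n.
Proof.
apply: (@le_trans _ _ (N n)); first by rewrite ler_nat; lia.
by rewrite ler_eXnr// /N ler1n.
Qed.

Lemma exists_scale : exists u : nat -> nat,
  [/\ forall n, V n * weighted_tail (u n).+1 <= 1,
      forall n, (0 < u n)%N -> 1 < V n * weighted_tail (u n) &
      u @ \oo --> \oo].
Proof.
have ex n : exists k, V n * weighted_tail k.+1 <= 1.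
  (* Since [T <= 1], the number of sites of the box already qualifies. *)
  exists ((2 * n).+1 ^ d)%N; rewrite /weighted_tail mulrA ler_pdivrMr ?ltr0n// mul1r.
  apply: (@le_trans _ _ (V n)); first by rewrite ler_piMr// ltW.
  by rewrite /V /N -natrX ler_nat.
exists (fun n => ex_minn (ex n)); split.
- by move=> n; case: ex_minnP.
- move=> n; case: ex_minnP => -[//|k] _ kmin _; rewrite ltNge; apply/negP => /kmin.
  by rewrite ltnn.
apply/cvgnyPge => A; near=> n; case: ex_minnP => k Vk _.
rewrite leqNgt; apply/negP => kA.
have : V n * weighted_tail A.+1 <= 1.
  apply: le_trans Vk; rewrite ler_pM2l//; apply: weighted_tail_le => //.
  by rewrite ltnS ltnW.
rewrite -ler_pdivlMr ?weighted_tail_gt0// mul1r leNgt => /negP; apply.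
apply: lt_le_trans (V_ge n); near: n; exact: nbhs_infty_gtr.
Unshelve. all: end_near. Qed.

Section Scale.
Variable u : nat -> nat.
Hypothesis u_le : forall n, V n * weighted_tail (u n).+1 <= 1.
Hypothesis u_gt : forall n, (0 < u n)%N -> 1 < V n * weighted_tail (u n).
Hypothesis u_oo : u @ \oo --> \oo.

Let U n := (u n).+1.

Let s0 : 0 < s. Proof. by rewrite divr_gt0. Qed.

Let U_oo : U @ \oo --> \oo.
Proof.
apply/cvgnyPge => A; have := cvgny_near_ge u_oo A.
by apply: filterS => n; rewrite /U; exact: leqW.
Qed.

Let U_poly_exp k : (fun n => (U n)%:R ^+ k * expR (- ((U n)%:R * s))) @ \oo --> (0 : R).
Proof. exact: (cvg_comp _ _ U_oo (@cvg_poly_exp R s k s0)). Qed.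

Let VT n : V n * T (U n) <= (U n)%:R.
Proof.
have := u_le n; rewrite /weighted_tail mulrA ler_pdivrMr ?ltr0n//.
by rewrite mul1r.
Qed.

(** This says that [U n] is at most logarithmic in n: minimality of [u n] bounds the inverse of
    [V n] by [T (u n)], which decays exponentially. The factor [expR s] in [D] pays for passing from
    [u n] to [U n]. *)
Let V_inv_le : exists2 D, 0 < D &
  \forall n \near \oo, (V n)^-1 <= D * expR (- ((U n)%:R * s)).
Proof.
have [C C0 hC] := tail_decay.
exists (C * expR s); first by rewrite mulr_gt0// expR_gt0.
near=> n; have un : (0 < u n)%N.
  by near: n; exact: (cvgny_near_ge u_oo 1).
apply: (@le_trans _ _ (weighted_tail (u n))).
  by rewrite -[leLHS]mul1r ler_pdivrMr// mulrC ltW// u_gt.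
apply: (@le_trans _ _ (T (u n))).
  by rewrite ler_pdivrMr ?ltr0n// ler_peMr// ler1n.
rewrite -mulrA -expRD /U -natr1 mulrDl mul1r opprD addrC addrNK; exact: hC.
Unshelve. all: end_near. Qed.

Let poly_V_cvg0 k : (fun n => (U n)%:R ^+ k / V n) @ \oo --> (0 : R).
Proof.
have [D D0 hD] := V_inv_le.
apply: (@squeeze_cvgr _ _ _ _ (cst 0)
  (fun n => D * ((U n)%:R ^+ k * expR (- ((U n)%:R * s))))); last 2 first.
- exact: cvg_cst.
- by rewrite -(mulr0 D); apply: cvgM; [exact: cvg_cst|exact: U_poly_exp].
near=> n; rewrite /= divr_ge0 ?exprn_ge0 ?(ltW (V_gt0 _))//= mulrCA.
by rewrite ler_wpM2l ?exprn_ge0//; near: n.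
Unshelve. all: end_near. Qed.

(** Its [d]-th power is a power of [U n] divided by [V n]. *)
Let UN_cvg0 : (fun n => (U n)%:R ^+ 2 / N n) @ \oo --> (0 : R).
Proof.
apply: (@cvg0_of_pow R _ d.-1) => [n|].
  by rewrite divr_ge0 ?exprn_ge0 ?(ltW (N_gt0 _)).
rewrite prednK//; under eq_fun do rewrite expr_div_n -exprM; exact: poly_V_cvg0.
Qed.

Lemma scale_small x : \forall n \near \oo, (2 * U n + x <= n)%N.
Proof.
(* Below this threshold (3 + x) U^2 <= n, and 2 U + x <= (3 + x) U^2 because U >= 1. *)
have e0 : 0 < (2 * (3 + x))%:R^-1 :> R by rewrite invr_gt0 ltr0n.
have [n0 _ hn] := cvgr_lt _ UN_cvg0 _ e0.
exists n0 => // n /hn; rewrite ltr_pdivrMr// mulrC ltr_pdivlMr ?ltr0n//.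
rewrite -natrX -natrM ltr_nat expnS expn1; have : (0 < U n)%N by [].
move: (U n) => k k0; nia.
Qed.

(** Going from [U n] to twice that size gains exp(- U s) over [V n * T (U n)], which is at most
    [U n]. *)
Lemma huge_cluster_error x :
  (fun n => V n * T (2 * U n + x)%N) @ \oo --> (0 : R).
Proof.
have [K hK] := tail_decay_rel.
apply: (@squeeze_cvgr _ _ _ _ (cst 0)
  (fun n => (U n)%:R ^+ 1 * expR (- ((U n)%:R * s)))); last 2 first.
- exact: cvg_cst.
- exact: U_poly_exp.
near=> n; rewrite /= mulr_ge0 ?T_ge0 ?(ltW (V_gt0 _))//= expr1.
have KU : (K <= U n)%N by near: n; exact: (cvgny_near_ge U_oo K).
apply: (@le_trans _ _ (V n * (expR (- ((U n)%:R * s)) * T (U n)))).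
  rewrite ler_pM2l//; apply: le_trans (hK _ _ KU); apply: T_le; lia.
by rewrite mulrCA mulrC ler_wpM2r ?expR_ge0.
Unshelve. all: end_near. Qed.

Lemma boundary_error x :
  (fun n => (2 * (2 * U n + x) * d)%:R * N n ^+ d.-1 * T (U n + x)%N) @ \oo --> (0 : R).
Proof.
pose c : R := (2 * (2 + x) * d)%:R.
apply: (@squeeze_cvgr _ _ _ _ (cst 0) (fun n => c * ((U n)%:R ^+ 2 / N n))); last 2 first.
- exact: cvg_cst.
- by rewrite -(mulr0 c); apply: cvgM; [exact: cvg_cst|exact: UN_cvg0].
near=> n; rewrite /= !mulr_ge0 ?T_ge0 ?exprn_ge0 ?(ltW (N_gt0 _))//=.
(* One factor [N n] is missing from [V n]; the thickness of the layer, at most a multiple of [U n],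
   supplies the second power of [U n]. *)
have h : N n ^+ d.-1 * T (U n + x)%N <= (U n)%:R / N n.
  rewrite ler_pdivlMr// mulrAC -exprSr prednK//.
  apply: le_trans (VT n); apply: ler_wpM2l; first exact: (ltW (V_gt0 n)).
  by rewrite T_le// leq_addr.
rewrite -mulrA; apply: le_trans (ler_wpM2l (ler0n _ _) h) _.
have -> : c * ((U n)%:R ^+ 2 / N n) = c * (U n)%:R * ((U n)%:R / N n) by ring.
apply: ler_wpM2r.
  by rewrite divr_ge0// ltW.
rewrite /c -natrM ler_nat; have : (0 < U n)%N by [].
by move: (U n) => k; nia.
Unshelve. all: end_near. Qed.

Lemma poisson_error x :
  (fun n => V n * (2 * (4 * (2 * U n + x)).+1 ^ d).+1%:R * T (U n + x)%N ^+ 2)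
    @ \oo --> (0 : R).
Proof.
pose c : R := (3 * (9 + 4 * x) ^ d)%:R.
apply: (@squeeze_cvgr _ _ _ _ (cst 0) (fun n => c * ((U n)%:R ^+ (d + 2) / V n))); last 2 first.
- exact: cvg_cst.
- by rewrite -(mulr0 c); apply: cvgM; [exact: cvg_cst|exact: poly_V_cvg0].
near=> n; rewrite /= !mulr_ge0 ?exprn_ge0 ?T_ge0 ?(ltW (V_gt0 _))//=.
have h : T (U n + x)%N <= (U n)%:R / V n.
  rewrite ler_pdivlMr// mulrC; apply: le_trans (VT n).
  by rewrite ler_pM2l// T_le// leq_addr.
(* As U >= 1, 4 (2 U + x) + 1 <= (9 + 4 x) U; the 3 in [c] absorbs the factor 2 and the
   successor. *)
have hc : (2 * (4 * (2 * U n + x)).+1 ^ d).+1%:R <= c * (U n)%:R ^+ d.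
  rewrite /c -natrX -natrM ler_nat -mulnA -expnMn.
  have : ((4 * (2 * U n + x)).+1 ^ d <= ((9 + 4 * x) * U n) ^ d)%N.
    rewrite leq_exp2r//; have : (0 < U n)%N by [].
    by move: (U n) => k; nia.
  have : (0 < ((9 + 4 * x) * U n) ^ d)%N by rewrite expn_gt0.
  lia.
have VTx : V n * T (U n + x)%N <= (U n)%:R.
  by apply: le_trans (VT n); rewrite ler_pM2l// T_le// leq_addr.
have h2 : V n * T (U n + x)%N ^+ 2 <= (U n)%:R ^+ 2 / V n.
  rewrite !expr2 [leLHS]mulrA -[leRHS]mulrA; apply: ler_pM => //.
  by rewrite mulr_ge0// ltW.
rewrite mulrAC mulrC exprD -mulrA [leRHS]mulrA; apply: ler_pM => //.
by rewrite mulr_ge0 ?sqr_ge0// ltW.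
Unshelve. all: end_near. Qed.

(** Minimality gives more than 1 at [u n], and one step to [U n] multiplies by a ratio tending to
    exp(- zeta). *)
Lemma intensity_lower : \forall n \near \oo,
  expR (- zeta) / 2 <= V n * weighted_tail (U n).
Proof.
have h := cvg_comp _ _ u_oo (@weighted_tail_shift 1).
have lt2 : expR (- zeta) / 2 < expR (- (1%:R * zeta)).
  by rewrite mul1r; have := expR_gt0 (- zeta); lra.
near=> n; have un : (0 < u n)%N by near: n; exact: (cvgny_near_ge u_oo 1).
apply: (@le_trans _ _ (weighted_tail (u n + 1) / weighted_tail (u n))).
  by near: n; exact: (cvgr_ge _ h _ lt2).
have G0 : 0 < weighted_tail (u n) by rewrite -(prednK un) weighted_tail_gt0.
rewrite ler_pdivrMr// addn1 mulrAC -[leLHS]mul1r ler_pM2r ?weighted_tail_gt0//.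
exact/ltW/u_gt.
Unshelve. all: end_near. Qed.

End Scale.

End TailAsymptotics.

(** * Replacing the Poisson intensity and the limit law of the maximal cluster *)

Lemma ler_dist_expRN (R : realType) (a b : R) : 0 <= a -> 0 <= b ->
  `|expR (- a) - expR (- b)| <= `|a - b|.
Proof.
wlog ab : a b / a <= b.
  move=> H a0 b0; have [/H|/ltW/H] := leP a b; first exact.
  by move=> h; rewrite distrC [leRHS]distrC; exact: h.
move=> a0 _; rewrite ger0_norm ?subr_ge0 ?ler_expR ?lerN2//.
rewrite distrC ger0_norm ?subr_ge0//.
have -> : expR (- b) = expR (- a) * expR (a - b).
  by rewrite -expRD addrA addNr add0r.
have h1 : 1 + (a - b) <= expR (a - b) by exact: expR_ge1Dx.
have h2 : expR (- a) <= expR 0 by rewrite ler_expR oppr_le0.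
rewrite expR0 in h2.
have h3 := expR_ge0 (- a).
nra.
Qed.

Unset Implicit Arguments.

Theorem theorem1p1 (R : realType) (d : nat) (d_ge1 : (1 <= d)%N)
    (P : R -> probability (config d) R)
    (P_perc : forall q : R, 0 <= q <= 1 -> site_percolation q (P q))
    (pc : R) (pc_crit : is_critical_value P pc)
    (p : R) (p_gt0 : 0 < p) (p_lt_pc : p < pc)
    (zeta : R) (zeta_gt0 : 0 < zeta)
    (zeta_lim :
      (fun n : nat => - (n%:R^-1 * ln (cluster_tail (P p) n))) @ \oo --> zeta)
    (tail_ratio :
      (fun n : nat => cluster_tail (P p) n.+1 / cluster_tail (P p) n) @ \oo
        --> expR (- zeta)) :
  exists (u : nat -> nat) (a : R) (a_ : nat -> R),
    [/\ u @ \oo --> \oo,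
        0 < a,
        forall n : nat, a <= a_ n <= 1 &
        forall x : nat,
          (fun n : nat =>
             fine (P p [set w : config d | (max_cluster n w <= u n + x)%N])
             - expR (- (a_ n * expR (- (x%:R * zeta))))) @ \oo --> (0 : R)].
Proof.
have pc1 : pc <= 1 by case: pc_crit => /andP[].
have perc : site_percolation p (P p).
  by apply: P_perc; rewrite (ltW p_gt0) (le_trans (ltW p_lt_pc)).
pose T := cluster_tail (P p).
have T0 k : 0 <= T k by exact: cluster_tail_ge0.
have T1 k : T k <= 1 by exact: cluster_tail_le1.
have Tle m n : (m <= n)%N -> T n <= T m by exact: cluster_tail_le.
have [u [u_le u_gt u_oo]] := exists_scale zeta_gt0 T0 T1 Tle tail_ratio d_ge1.
pose V n : R := (2 * n).+1%:R ^+ d.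
pose U n := (u n).+1.
pose G := weighted_tail T.
have G_gt0 k : 0 < G k.+1 by exact: (weighted_tail_gt0 T0 Tle tail_ratio).
pose c : R := expR (- zeta) / 2.
have c0 : 0 < c by rewrite divr_gt0// expR_gt0.
have c1 : c <= 1.
  have : expR (- zeta) <= expR 0 by rewrite ler_expR oppr_le0 ltW.
  by rewrite expR0 /c; lra.
(* The intensity is above [c] only for large n; the maximum secures the lower bound for every n. *)
pose a_ n := Num.max c (V n * G (U n)).
exists u, c, a_; split => //.
  by move=> n; rewrite le_max lexx ge_max c1 u_le.
move=> x; set l := expR (- (x%:R * zeta)).
pose q k := pr (P p) (cluster_start (k + x)%N (2 * k + x)%N 0).
have q_cvg : (fun k => q k / G k) @ \oo --> l.
  apply: (ratio_cvg_of_bounds zeta_gt0 T0 Tle tail_ratio) => [k|k j jk].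
    by apply: (start_prob_upper perc) => //; lia.
  by apply: (start_prob_lower perc) => //; lia.
have Uoo : U @ \oo --> \oo.
  apply/cvgnyPge => A; near=> n; rewrite /U leqW//.
  by near: n; exact: cvgny_near_ge.
have q_err : (fun n => `|q (U n) / G (U n) - l|) @ \oo --> (0 : R).
  have := cvg_comp _ _ Uoo q_cvg => h.
  rewrite -(normr0 R) -(subrr l); apply: cvg_norm; apply: cvgB; [exact: h|exact: cvg_cst].
pose err1 n := V n * T (2 * U n + x)%N.
pose err2 n := (2 * (2 * U n + x) * d)%:R * (2 * n).+1%:R ^+ d.-1 * T (U n + x)%N.
pose err3 n := V n * (2 * (4 * (2 * U n + x)).+1 ^ d).+1%:R * T (U n + x)%N ^+ 2.
have h1 : err1 @ \oo --> (0 : R).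
  exact: (huge_cluster_error zeta_gt0 T0 Tle tail_ratio d_ge1 u_le u_oo).
have h2 : err2 @ \oo --> (0 : R).
  exact: (boundary_error zeta_gt0 T0 T1 Tle tail_ratio d_ge1 u_le u_gt u_oo).
have h3 : err3 @ \oo --> (0 : R).
  exact: (poisson_error zeta_gt0 T0 T1 Tle tail_ratio d_ge1 u_le u_gt u_oo).
have small := scale_small zeta_gt0 T0 T1 Tle tail_ratio d_ge1 u_gt u_oo x.
have lower := intensity_lower T0 Tle tail_ratio u_gt u_oo.
apply/norm_cvg0P.
apply: (@squeeze_cvgr _ _ _ _ (cst 0)
  (fun n => err1 n + err2 n + err3 n + `|q (U n) / G (U n) - l|)); last 2 first.
- exact: cvg_cst.
- rewrite -[0]addr0 -[X in X + 0]addr0 -[X in X + 0 + 0]addr0.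
  by do 3 apply: cvgD => //.
near=> n; rewrite /= normr_ge0 /=.
have Ln : (2 * U n + x <= n)%N by near: n.
have aE : a_ n = V n * G (U n).
  by apply: max_r; near: n.
have tL : (u n + x < 2 * U n + x <= n)%N by rewrite Ln andbT /U; lia.
have := max_cluster_poisson perc d_ge1 tL.
rewrite -[(u n + x).+1]/(U n + x)%N -/(q (U n)).
set A := pr _ _; rewrite -[fine _]/A.
have -> : ((2 * n).+1 ^ d)%:R = V n :> R by rewrite natrX.
move=> hA.
(* The intermediate term uses the exact expected number of starts in the box, [V n * q (U n)]. *)
apply: le_trans (ler_distD (expR (- (V n * q (U n)))) _ _) _.
apply: lerD.
  apply: le_trans hA _; rewrite /err1 /err2 /err3.
  by rewrite !natrM !natrX.
have qU0 : 0 <= q (U n) by exact: pr_ge0.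
have V0 : 0 < V n by rewrite exprn_gt0.
have l0 : 0 <= l by exact: expR_ge0.
have GU : 0 < G (U n) by exact: G_gt0.
have VG0 : 0 <= V n * G (U n) by rewrite mulr_ge0// ltW.
rewrite aE; apply: le_trans (ler_dist_expRN _ _) _.
- by rewrite mulr_ge0// ltW.
- exact: mulr_ge0.
(* As the intensity is at most 1, the error of the ratio [q / G] is not amplified. *)
have -> : V n * q (U n) - V n * G (U n) * l = V n * G (U n) * (q (U n) / G (U n) - l).
  by field; rewrite gt_eqF.
by rewrite normrM ger0_norm// ler_piMl// u_le.
Unshelve. all: end_near. Qed.
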